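(* Let $\mathcal{G}$ be the X graph: a star-graph with four edges $e_1,e_2,e_3,e_4$, all of length $1$, meeting at one interior vertex. Impose Neumann boundary conditions at the exterior vertices of $e_1$ and $e_2$ and Dirichlet boundary conditions at the exterior vertices of $e_3$ and $e_4$, and let $\omega=e_1\cup e_3$. Then, for any time $T>4$, the wave equation $$\partial_t^2u=\Delta_{\mathcal{G}}u+h1_\omega,\quad t>0,\qquad (u,\partial_tu)(t=0)=(u_0,u_1)\in H^1_\Delta(\mathcal{G})\times L^2(\mathcal{G})$$ is exactly controllable at time $T$.
   Context: Each edge is identified with the interval $(0,1)$, the end $0$ being the common interior vertex and the end $1$ the exterior vertex. $\mathcal{G}$ is identified with the disjoint union of its edges. $L^2(\mathcal{G})=\prod_{j=1}^4L^2(0,1)$ (real-valued functions). $H^1_\Delta(\mathcal{G})$ is the set of $u=(u_j)\in\prod_{j=1}^4H^1(0,1)$ with $u_1(0)=u_2(0)=u_3(0)=u_4(0)$ and $u_3(1)=u_4(1)=0$, with the $H^1$ norm. $D(\Delta_{\mathcal{G}})$ is the set of $u\in\prod_jH^2(0,1)$ belonging to $H^1_\Delta(\mathcal{G})$ with $\sum_{j=1}^4\partial_xu_j(0)=0$ (Kirchhoff's condition) and $\partial_xu_1(1)=\partial_xu_2(1)=0$; $(\Delta_{\mathcal{G}}u)_j=\partial_x^2u_j$. Exact controllability at time $T$: for all $(u_0,u_1),(v_0,v_1)\in H^1_\Delta(\mathcal{G})\times L^2(\mathcal{G})$ there exists $h\in L^2((0,T)\times\omega)$ such that the solution $u\in C^1([0,T],L^2(\mathcal{G}))\cap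 C^0([0,T],H^1_\Delta(\mathcal{G}))$ of the wave equation with initial state $(u_0,u_1)$ satisfies $(u,\partial_tu)(t=T)=(v_0,v_1)$. *)

(* Defs.v *)
From HB Require Import structures.
From mathcomp Require Import all_boot all_order all_algebra.
From mathcomp Require Import all_classical all_reals all_analysis.

Set Implicit Arguments.
Unset Strict Implicit.
Unset Printing Implicit Defensive.

Import Order.TTheory GRing.Theory Num.Theory.
Import numFieldNormedType.Exports.

Local Open Scope classical_set_scope.
Local Open Scope ring_scope.

Definition e1 : 'I_4 := @Ordinal 4 0 isT.
Definition e2 : 'I_4 := @Ordinal 4 1 isT.
Definition e3 : 'I_4 := @Ordinal 4 2 isT.
Definition e4 : 'I_4 := @Ordinal 4 3 isT.

Definition omega : {set 'I_4} := [set e1; e3]%SET.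

(* A function on the graph is the family of its restrictions to the edges; only
   the values at parameters in [0, 1] are ever used. *)
Definition graph_fun (R : realType) := 'I_4 -> R -> R.

Definition L2norm (R : realType) (f : R -> R) : \bar R :=
  ('N[lebesgue_measure]_(2%:E)[EFin \o (f \_ `]0%R, 1%R[)%R])%E.

Definition L2 (R : realType) (f : R -> R) : Prop :=
  f \_ `]0, 1[ \in Lfun (@lebesgue_measure R) 2%:E.

(* C^1 functions with compact support in (0,1): a closed subset of R contained
   in (0,1) is compact. *)
Definition test_fun (R : realType) (phi : R -> R) : Prop :=
  [/\ forall x, derivable phi x 1,
      continuous phi^`()%classic
    & closure [set x | phi x != 0] `<=` `]0, 1[ ].

Definition weak_derivative (R : realType) (u g : R -> R) : Prop :=
  forall phi : R -> R, test_fun phi ->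
    \int[lebesgue_measure]_(x in `]0, 1[) (u x * phi^`()%classic x) =
    - \int[lebesgue_measure]_(x in `]0, 1[) (g x * phi x).

(* An element of H^1(0,1) is given by its representative which is continuous on
   [0,1], so that its traces at the ends are the values u 0 and u 1. *)
Definition H1 (R : realType) (u : R -> R) : Prop :=
  [/\ {within `[0, 1], continuous u}, L2 u
    & exists2 g, L2 g & weak_derivative u g].

Definition L2G (R : realType) (u : graph_fun R) : Prop := forall j, L2 (u j).

Definition H1Delta (R : realType) (u : graph_fun R) : Prop :=
  [/\ forall j, H1 (u j),
      u e1 0 = u e2 0 /\ u e2 0 = u e3 0 /\ u e3 0 = u e4 0
    & u e3 1 = 0 /\ u e4 1 = 0].

(* "u belongs to D(Delta_G) and Delta_G u = f".  Since du j is the continuous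
   representative of the derivative of u j, the end values of this derivative
   are du j 0 and du j 1. *)
Definition graph_laplacian (R : realType) (u f : graph_fun R) : Prop :=
  H1Delta u /\
  exists du : graph_fun R,
    [/\ forall j, weak_derivative (u j) (du j) /\ H1 (du j),
        forall j, L2 (f j) /\ weak_derivative (du j) (f j),
        \sum_(j < 4) du j 0 = 0
      & du e1 1 = 0 /\ du e2 1 = 0].

(* h j (t, x) is the control at time t and at the point x of the edge j. *)
Definition L2control (R : realType) (T : R) (h : 'I_4 -> R * R -> R) : Prop :=
  forall j, j \in omega ->
    h j \_ (`]0, T[ `*` `]0, 1[)
      \in Lfun (@lebesgue_measure R \x @lebesgue_measure R)%E 2%:E.

Definition source (R : realType) (h : 'I_4 -> R * R -> R) (t : R) :
    graph_fun R :=
  fun j x => if j \in omega then h j (t, x) else 0.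

Definition continuous_L2G (R : realType) (T : R) (w : R -> graph_fun R) :
    Prop :=
  forall t, t \in `[0, T] -> forall j,
    L2norm (w s j \- w t j) @[s --> within `[0, T] (nbhs t)] --> 0%E.

Definition continuous_H1Delta (R : realType) (T : R) (u : R -> graph_fun R) :
    Prop :=
  (forall t, t \in `[0, T] -> H1Delta (u t)) /\
  exists2 ux : R -> graph_fun R,
    (forall t, t \in `[0, T] ->
       forall j, L2 (ux t j) /\ weak_derivative (u t j) (ux t j))
    & continuous_L2G T u /\ continuous_L2G T ux.

(* u belongs to C^1([0,T], L^2(G)) and v is its time derivative. *)
Definition C1_L2G (R : realType) (T : R) (u v : R -> graph_fun R) : Prop :=
  [/\ forall t, t \in `[0, T] -> L2G (u t) /\ L2G (v t),
      continuous_L2G T v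
    & forall t, t \in `[0, T] -> forall j,
        L2norm (fun x => (u s j x - u t j x) / (s - t) - v t j x)
          @[s --> within `[0, T] t^'] --> 0%E].

Definition eq_H1Delta (R : realType) (u w : graph_fun R) : Prop :=
  forall j x, x \in `[0, 1] -> u j x = w j x.

Definition eq_L2G (R : realType) (u w : graph_fun R) : Prop :=
  forall j, {ae lebesgue_measure, forall x, x \in `]0, 1[ -> u j x = w j x}.

(* For initial data in H^1_Delta x L^2 the solution is the mild one, i.e. the
   equation is understood in its time-integrated form
     d_t u(t) = u1 + Delta_G (int_0^t u(s) ds) + int_0^t h(s) 1_omega ds
   in L^2(G), the first integral being required to belong to D(Delta_G). *)
Definition wave_solution (R : realType) (T : R) (h : 'I_4 -> R * R -> R)
    (u0 u1 : graph_fun R) (u v : R -> graph_fun R) : Prop :=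
  [/\ C1_L2G T u v, continuous_H1Delta T u,
      eq_H1Delta (u 0) u0, eq_L2G (v 0) u1
    & forall t, t \in `[0, T] ->
        exists2 f : graph_fun R,
          graph_laplacian
            (fun j x => \int[lebesgue_measure]_(s in `]0, t[) u s j x) f
          & eq_L2G (v t)
              (fun j x => u1 j x + f j x +
                 \int[lebesgue_measure]_(s in `]0, t[) source h s j x)].

Definition exactly_controllable (R : realType) (T : R) : Prop :=
  forall u0 u1 v0 v1 : graph_fun R,
    H1Delta u0 -> L2G u1 -> H1Delta v0 -> L2G v1 ->
    exists2 h : 'I_4 -> R * R -> R,
      L2control T h
      & exists u v : R -> graph_fun R,
          [/\ wave_solution T h u0 u1 u v,
              eq_H1Delta (u T) v0
            & eq_L2G (v T) v1].

(* Main.v *)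
From HB Require Import structures.
From mathcomp Require Import all_boot all_order all_algebra.
From mathcomp Require Import all_classical all_reals all_analysis.
From mathcomp Require Import measurable_realfun ring lra.
Require Import Defs.

Set Implicit Arguments.
Unset Strict Implicit.
Unset Printing Implicit Defensive.

Import Order.TTheory GRing.Theory Num.Theory.
Import numFieldNormedType.Exports.

Local Open Scope classical_set_scope.
Local Open Scope ring_scope.

(* On an edge, a wave is determined by its outgoing profile g at the vertex:
   u_t(t, 0) = g(t) + s g(t - 2), where s = 1 for a Neumann and s = - 1 for a
   Dirichlet exterior end; the initial state prescribes g on (-2, 0) and the
   final state prescribes it on (T - 2, T).

   On the two uncontrolled edges e2, e4 the profiles g2, g4 must produce the
   same vertex trace, i.e. g2 - g4 = - (g2 + g4)(. - 2), so that g2 + g4 is the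
   only unknown. Imposing Kirchhoff's law at the vertex for t < d and for
   t > T - d, the initial state determines g2 + g4 on (-2, d) and the final
   state determines it on (T - 4 - d, T); it is free in between, and these
   intervals are disjoint for some d > 0 because T > 4.

   On a controlled edge, the wave leaving the initial state and the wave
   arriving at the final state, both with the vertex trace found above, are
   glued by cut-offs in time, the error being absorbed by the control. Finally
   the defect in Kirchhoff's law, which vanishes for t < d and t > T - d, is
   corrected by a wave on e3 that is localized near the vertex and has zero
   trace there. *)

(** * Locally integrable functions and their primitives *)

(** The states are only in H^1 x L^2, so a profile is merely square integrable and cannot be
    differentiated. This dictates the form of all building blocks: sums of products
    [m(t) n(x) G(t + e x)], with C^2 cut-offs and [G] a primitive of the profile. The source of such
    a product contains no derivative of the profile, hence is an admissible control. Its fluxes at a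
    fixed [x] are square integrable in time, so that the defect in Kirchhoff's law can itself serve
    as a profile.

    The time 4 is two round trips on an edge. The final state prescribes both [g2 + g4] and
    [g2 - g4] on (T - 2, T), and the delay relation turns the latter into a condition on [g2 + g4]
    on (T - 4, T - 2). It matters here that the free edges reflect with opposite signs: with equal
    signs the equality of traces would read [g2 - g4 = - (g2 - g4)(. - 2)], a recurrence for the
    difference alone, and its final value could not be chosen. *)

Section locint.
Context {R : realType}.
Notation mu := (@lebesgue_measure R).
Notation RM := (measurableTypeR R).
Implicit Types (f g u n : R -> R) (a b c : R).

(** The data live on (0, 1), but d'Alembert's formula evaluates profiles at arbitrary times; hence
    functions on the whole line, integrable on each segment. *)
Definition locint f := forall a b, mu.-integrable `[a, b] (EFin \o f).

(** The orientation makes Chasles' relation and the change of variables by a reflection hold without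
    ordering the end points. *)
Definition itg f a b : R :=
  if a <= b then \int[mu]_(x in `[a, b]) f x
  else - \int[mu]_(x in `[b, a]) f x.

Lemma itgE f a b : a <= b -> itg f a b = \int[mu]_(x in `[a, b]) f x.
Proof. by rewrite /itg => ->. Qed.

Lemma itg_swap f a b : itg f b a = - itg f a b.
Proof.
rewrite /itg; have [ab|ba|->] := ltgtP a b.
- by [].
- by rewrite opprK.
- by rewrite set_itv1 Rintegral_set1 oppr0.
Qed.

Lemma itgxx f a : itg f a a = 0.
Proof. by rewrite itgE// set_itv1 Rintegral_set1. Qed.

Lemma itg_cat f a b c : locint f -> itg f a b + itg f b c = itg f a c.
Proof.
move=> lf.
suff H x y z : x <= y -> y <= z -> itg f x y + itg f y z = itg f x z.
  have S := itg_swap f.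
  have [ab|/ltW ab] := leP a b; have [bc|/ltW bc] := leP b c;
    have [ac|/ltW ac] := leP a c.
  - exact: H.
  - have := H b c a bc ac; have := H a b c ab bc.
    by rewrite (S a c) (S a b) => *; lra.
  - have := H a c b ac bc; rewrite (S b c); lra.
  - have := H c a b ac ab; rewrite (S b c) (S a c); lra.
  - have := H b a c ab ac; rewrite (S a b); lra.
  - have := H b c a bc ac; rewrite (S a b) (S a c); lra.
  - have := H c b a bc ab; have := H b a c ab ac.
    rewrite (S a b) (S b c) (S a c) => *; lra.
  - have := H c b a bc ab; rewrite (S a b) (S b c) (S a c); lra.
move=> xy yz; rewrite !itgE//; last exact: le_trans yz.
rewrite -(@Rintegral_itv_obnd_cbnd _ y (BRight z)); last first.
  by apply: integrableS (lf y z) => //; apply: subset_itvr; rewrite bnd_simp.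
rewrite -(@Rintegral_itvB _ f (BLeft x) (BRight z) y) ?bnd_simp//.
  by rewrite addrC subrK.
Qed.

Lemma locintD f g : locint f -> locint g -> locint (fun x => f x + g x).
Proof.
move=> lf lg a b; rewrite [X in _.-integrable _ X](_ : _ = (EFin \o f) \+ (EFin \o g))//.
exact: integrableD.
Qed.

Lemma locintZ k f : locint f -> locint (fun x => k * f x).
Proof. by move=> lf a b; exact: (@integrableZl _ RM _ mu _ (measurable_itv _) k _ (lf a
  b)). Qed.

Lemma locintN f : locint f -> locint (fun x => - f x).
Proof. by move=> lf a b; exact: (integrableN (lf a b)). Qed.

Lemma locintB f g : locint f -> locint g -> locint (fun x => f x - g x).
Proof. by move=> lf lg; apply: locintD => //; exact: locintN. Qed.

Lemma itgD f g a b : locint f -> locint g ->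
  itg (fun x => f x + g x) a b = itg f a b + itg g a b.
Proof.
move=> lf lg; rewrite /itg; case: ifP => _; rewrite RintegralD//.
by rewrite opprD.
Qed.

Lemma itgZ k f a b : locint f -> itg (fun x => k * f x) a b = k * itg f a b.
Proof.
by move=> lf; rewrite /itg; case: ifP => _; rewrite RintegralZl// ?mulrN//; exact: lf.
Qed.

Lemma itgN f a b : locint f -> itg (fun x => - f x) a b = - itg f a b.
Proof.
move=> lf; rewrite -mulN1r -itgZ//; congr itg.
by apply/funext => x; rewrite mulN1r.
Qed.

Lemma itgB f g a b : locint f -> locint g ->
  itg (fun x => f x - g x) a b = itg f a b - itg g a b.
Proof. by move=> lf lg; rewrite itgD ?itgN//; exact: locintN. Qed.

Let measE (D : set RM) f :
  measurable_fun D (EFin \o f) <-> measurable_fun D (f : RM -> R).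
Proof. exact: (@measurable_EFinP _ RM R D f). Qed.

Lemma locint_measurable f : locint f -> measurable_fun (setT : set RM) f.
Proof.
move=> lf.
have -> : [set: RM] = \bigcup_n `[- n%:R, n%:R]%classic.
  apply/seteqP; split => // x _; exists (Num.truncn `|x|).+1 => //=.
  by rewrite in_itv/= -ler_norml ltW// truncnS_gt.
apply/measurable_fun_bigcup => [n|n]; first by [].
apply/measE; exact: (measurable_int mu (lf _ _)).
Qed.

(** The bridge to weak derivatives and mild solutions, which integrate over open intervals. *)
Lemma itg_bndoo f a b : locint f -> a <= b -> itg f a b = \int[mu]_(x in `]a, b[) f x.
Proof.
move=> lf ab; rewrite itgE// /Rintegral; congr fine.
rewrite -(@integral_itv_bndoo _ a b (EFin \o f) true false)//.
by apply/measE; apply: measurable_funTS; exact: locint_measurable.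
Qed.

Lemma eq_itg f g a b : locint f -> locint g -> a <= b ->
  (forall x, a < x -> x < b -> f x = g x) -> itg f a b = itg g a b.
Proof.
move=> lf lg ab fg; rewrite !itg_bndoo//; apply: eq_Rintegral => x.
by rewrite inE/= in_itv/= => /andP[]; exact: fg.
Qed.

Lemma le_itg f g a b : locint f -> locint g -> a <= b ->
  (forall x, a <= x -> x <= b -> f x <= g x) -> itg f a b <= itg g a b.
Proof.
move=> lf lg ab fg; rewrite !itgE//; apply: le_Rintegral => //.
by move=> x /=; rewrite in_itv/= => /andP[]; exact: fg.
Qed.

Lemma itg_cst k a b : itg (fun=> k) a b = k * (b - a).
Proof.
suff H x y : x <= y -> itg (fun=> k) x y = k * (y - x).
  have [/H//|/ltW/H] := leP a b.
  by rewrite itg_swap => e; lra.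
move=> xy; rewrite itgE//.
have -> : \int[mu]_(x in `[x, y]) k = k * fine (mu `[x, y]) by exact: Rintegral_cst.
rewrite lebesgue_measure_itv/= lte_fin.
have [_ //|yx|<-] := ltgtP x y; last by rewrite subrr.
by move: xy; rewrite leNgt yx.
Qed.

Lemma continuous_locint f : continuous f -> locint f.
Proof.
move=> cf a b; apply: continuous_compact_integrable; first exact: segment_compact.
exact: continuous_subspaceT.
Qed.

Lemma itg_ge0 f a b : a <= b -> (forall x, a <= x -> x <= b -> 0 <= f x) ->
  0 <= itg f a b.
Proof.
move=> ab f0; rewrite itgE//; apply: Rintegral_ge0 => x /=.
by rewrite in_itv/= => /andP[]; exact: f0.
Qed.

Lemma locint_norm f : locint f -> locint (fun x => `|f x|).
Proof. by move=> lf a b; exact: (integrable_norm (lf a b)). Qed.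

Lemma locint_le f g : measurable_fun (setT : set RM) f -> locint g ->
  (forall x, `|f x| <= g x) -> locint f.
Proof.
move=> mf lg fg a b; apply: (le_integrable _ _ _ (lg a b)) => //.
  by apply/measE; apply: measurable_funTS.
by move=> x _; rewrite /= lee_fin (le_trans (fg x))// ler_norm.
Qed.

End locint.

(** * Translations and reflections of the line *)

Section affine.
Context {R : realType}.
Notation mu := (@lebesgue_measure R).
Notation RM := (measurableTypeR R).
Implicit Types (f g : R -> R) (a b c : R).

(** Change of variables for a measure preserving map is the push-forward formula. For translations
    and reflections the invariance follows from the uniqueness of Lebesgue measure, tested on
    half-open intervals. *)
Let integral_affine (phi : RM -> RM) (f : RM -> R) (D : set RM) :
  measurable_fun setT phi ->
  (forall A, measurable A -> pushforward mu phi A = mu A) ->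
  measurable D -> measurable_fun setT f -> mu.-integrable D (EFin \o f) ->
  mu.-integrable (phi @^-1` D) (EFin \o (f \o phi)) /\
  \int[mu]_(x in phi @^-1` D) f (phi x) = \int[mu]_(x in D) f x.
Proof.
move=> mphi muE mD mf fD.
have mEf : measurable_fun (setT : set RM) (EFin \o f) by exact/measurable_EFinP.
have pD : measurable (phi @^-1` D) by rewrite -[X in measurable X]setTI; exact: mphi.
have iphi : mu.-integrable (phi @^-1` D) (EFin \o (f \o phi)).
  apply/integrableP; split.
    by apply/measurable_EFinP; apply: measurable_funTS; exact: measurableT_comp.
  have /integrableP[_] := fD; apply: le_lt_trans.
  have <- : (\int[pushforward mu phi]_(x in D) `|(EFin \o f) x| =
     \int[mu]_(x in D) `|(EFin \o f) x|)%E.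
    by apply: eq_measure_integral => A mA _; exact: muE.
  rewrite (@ge0_integral_pushforward _ _ _ _ _ _ mphi mu D (abse \o (EFin \o f)))//.
    by apply: measurableT_comp => //; exact: measurable_funTS.
  by move=> y _; exact: abse_ge0.
split => //; rewrite /Rintegral; congr fine.
rewrite -(@integral_pushforward _ _ _ _ _ _ mphi mu D (EFin \o f))//.
by apply: eq_measure_integral => A mA _; exact: muE.
Qed.

Let pushforward_shift c (A : set RM) : measurable A ->
  pushforward mu ((fun x => x + c) : RM -> RM) A = mu A.
Proof.
have mc : measurable_fun (setT : set RM) ((fun x => x + c) : RM -> RM).
  exact: measurable_funD.
move=> mA; apply/esym.
apply: (@lebesgue_measure_unique R (pushforward mu (fun x : RM => x + c : RM))) =>
  //= _ [[a b]] _ <-.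
rewrite /pushforward.
rewrite (_ : (fun x => x + c) @^-1` _ = `]a - c, b - c]%classic); last first.
  by apply/seteqP; split => x /=; rewrite !in_itv/= ltrBlDr lerBrDr.
rewrite !lebesgue_measure_itv/= !lte_fin ltrD2r.
by congr (if _ then _ else _); rewrite -!EFinB; congr EFin; ring.
Qed.

Let pushforward_refl c (A : set RM) : measurable A ->
  pushforward mu ((fun x => c - x) : RM -> RM) A = mu A.
Proof.
have mc : measurable_fun (setT : set RM) ((fun x => c - x) : RM -> RM).
  exact: measurable_funB.
move=> mA; apply/esym.
apply: (@lebesgue_measure_unique R (pushforward mu (fun x : RM => c - x : RM))) =>
  //= _ [[a b]] _ <-.
rewrite /pushforward.
rewrite (_ : (fun x => c - x) @^-1` _ = `[c - b, c - a[%classic); last first.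
  by apply/seteqP; split => x /=; rewrite !in_itv/= ltrBrDr lerBlDr => /andP[? ?];
    apply/andP; split; lra.
rewrite !lebesgue_measure_itv/= !lte_fin ltrD2l ltrN2.
by congr (if _ then _ else _); rewrite -!EFinB; congr EFin; ring.
Qed.

Lemma itg_shift f c a b : locint f -> itg (fun x =>
  f (x + c)) a b = itg f (a + c) (b + c).
Proof.
move=> lf.
have mc : measurable_fun (setT : set RM) ((fun x => x + c) : RM -> RM).
  exact: measurable_funD.
have H x y : \int[mu]_(t in `[x, y]) f (t + c) = \int[mu]_(t in `[x + c, y + c]) f t.
  have [_ <-] := integral_affine mc (pushforward_shift c) (measurable_itv _)
    (locint_measurable lf) (lf (x + c) (y + c)).
  congr (Rintegral mu _ _).
  by apply/seteqP; split => t /=; rewrite !in_itv/= !lerD2r.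
by rewrite /itg !H lerD2r.
Qed.

Lemma locint_shift f c : locint f -> locint (fun x => f (x + c)).
Proof.
move=> lf a b.
have mc : measurable_fun (setT : set RM) ((fun x => x + c) : RM -> RM).
  exact: measurable_funD.
have [+ _] := integral_affine mc (pushforward_shift c) (measurable_itv _)
    (locint_measurable lf) (lf (a + c) (b + c)).
congr (is_true (_.-integrable _ _)).
by apply/seteqP; split => t /=; rewrite !in_itv/= !lerD2r.
Qed.

Lemma itg_refl f c a b : locint f -> itg (fun x => f (c - x)) a b = itg f (c - b) (c - a).
Proof.
move=> lf.
have mc : measurable_fun (setT : set RM) ((fun x => c - x) : RM -> RM).
  exact: measurable_funB.
have H x y : \int[mu]_(t in `[x, y]) f (c - t) = \int[mu]_(t in `[c - y, c - x]) f t.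
  have [_ <-] := integral_affine mc (pushforward_refl c) (measurable_itv _)
    (locint_measurable lf) (lf (c - y) (c - x)).
  congr (Rintegral mu _ _).
  by apply/seteqP; split => t /=; rewrite !in_itv/= => /andP[? ?]; apply/andP; split; lra.
by rewrite /itg !H lerD2l lerN2.
Qed.

Lemma locint_refl f c : locint f -> locint (fun x => f (c - x)).
Proof.
move=> lf a b.
have mc : measurable_fun (setT : set RM) ((fun x => c - x) : RM -> RM).
  exact: measurable_funB.
have [+ _] := integral_affine mc (pushforward_refl c) (measurable_itv _)
    (locint_measurable lf) (lf (c - b) (c - a)).
congr (is_true (_.-integrable _ _)).
by apply/seteqP; split => t /=; rewrite !in_itv/= => /andP[? ?]; apply/andP; split; lra.
Qed.

End affine.

(** * Oriented double integrals and Fubini's theorem *)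

Section locint2.
Context {R : realType}.
Notation mu := (@lebesgue_measure R).
Notation RM := (measurableTypeR R).
Implicit Types (F : R -> R -> R) (a b c d : R).

(** Fubini's theorem gives integrable sections only for almost every parameter. Demanding it of
    every section makes the inner integrals meaningful at each parameter, so that identities between
    them hold pointwise. *)
Record locint2 F : Prop := Locint2 {
  locint2_measurable :
    measurable_fun (setT : set (RM * RM)) (fun z => F z.1 z.2 : R);
  locint2_sec1 : forall s, locint (F s);
  locint2_sec2 : forall x, locint (F ^~ x);
  locint2_box : forall a b c d,
    (mu \x mu)%E.-integrable (`[a, b] `*` `[c, d]) (fun z => (F z.1 z.2)%:E) }.

(** Extension by zero from a box to the plane, where Fubini's theorem for the full product measure
    applies. *)
Let restr F a b c d : RM * RM -> \bar R :=
  (fun z : RM * RM => (F z.1 z.2)%:E) \_ ((`[a, b] `*` `[c, d]) : set (RM * RM)).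

Let restr_int F a b c d : locint2 F -> (mu \x mu)%E.-integrable setT (restr F a b c d).
Proof.
move=> iF; have mX : measurable ((`[a, b] `*` `[c, d]) : set (RM * RM)).
  by apply: measurableX; exact: measurable_itv.
by apply/(integrable_mkcond _ mX); exact: (locint2_box iF).
Qed.

Let restr1 F a b c d s : locint2 F -> c <= d ->
  (\int[mu]_x restr F a b c d (s, x))%E =
  ((EFin \o (fun s => itg (F s) c d)) \_ `[a, b]) s.
Proof.
move=> iF cd; rewrite [RHS]/patch; case: ifPn => [|/negP] sab.
  rewrite /= itgE// fineK; last first.
    by apply: integrable_fin_num => //; exact: locint2_sec1.
  rewrite [RHS]integral_mkcond; apply: eq_integral => x _.
  rewrite /restr /patch; congr (if _ then _ else _).
  by apply/idP/idP; rewrite !inE/=; [case|split => //]; rewrite inE in sab.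
rewrite integral0_eq// => x _; rewrite /restr /patch ifF//.
by apply/negP; rewrite inE => -[/= sab' _]; apply: sab; rewrite inE.
Qed.

Let restr2 F a b c d x : locint2 F -> a <= b ->
  (\int[mu]_s restr F a b c d (s, x))%E =
  ((EFin \o (fun x => itg (F ^~ x) a b)) \_ `[c, d]) x.
Proof.
move=> iF cd; rewrite [RHS]/patch; case: ifPn => [|/negP] sab.
  rewrite /= itgE// fineK; last first.
    by apply: integrable_fin_num => //; exact: locint2_sec2.
  rewrite [RHS]integral_mkcond; apply: eq_integral => s _.
  rewrite /restr /patch; congr (if _ then _ else _).
  by apply/idP/idP; rewrite !inE/=; [case|split => //]; rewrite inE in sab.
rewrite integral0_eq// => s _; rewrite /restr /patch ifF//.
by apply/negP; rewrite inE => -[/= _ sab']; apply: sab; rewrite inE.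
Qed.

Let restr_flip F a b c d s x :
  restr F a b c d (s, x) = restr (fun x s => F s x) c d a b (x, s).
Proof.
rewrite /restr !patchE (_ : ((s, x) \in _) = ((x, s) \in `[c, d] `*` `[a, b]))//.
by apply/idP/idP; rewrite !inE/= => -[].
Qed.

Let measurable_flip F :
  measurable_fun (setT : set (RM * RM)) (fun z => F z.1 z.2 : R) ->
  measurable_fun (setT : set (RM * RM)) (fun z => F z.2 z.1 : R).
Proof.
move=> mF.
have -> : (fun z : RM * RM => F z.2 z.1 : R) =
  (fun z : RM * RM => F z.1 z.2) \o (fun z : RM * RM => (z.2, z.1)) by [].
by apply: measurableT_comp => //; exact: measurable_fun_pair.
Qed.

Lemma locint2_flip F : locint2 F -> locint2 (fun x s => F s x).
Proof.
move=> iF; have [mF F1 F2 Fb] := iF; split => //.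
  exact: measurable_flip.
move=> c d a b; apply/integrable_mkcond.
  by apply: measurableX; exact: measurable_itv.
have /[dup] /(measurable_int _) mr := restr_int a b c d iF.
move=> /(integrable21ltyP _ _ mr) fin.
apply/integrable12ltyP.
  apply/(measurable_restrictT _ _).1; first by apply: measurableX; exact: measurable_itv.
  apply: measurable_funTS; apply/measurable_EFinP.
  exact: measurable_flip.
suff -> : (\int[mu]_x \int[mu]_s `|restr (fun x s => F s x) c d a b (x, s)| =
    \int[mu]_x \int[mu]_s `|restr F a b c d (s, x)|)%E by [].
by apply: eq_integral => x _; apply: eq_integral => s _; rewrite restr_flip.
Qed.

Lemma locint2_itg1 F c d : locint2 F -> locint (fun s => itg (F s) c d).
Proof.
move=> iF; wlog cd : c d / c <= d => [H|].
  have [/H//|/ltW/H/locintN] := leP c d.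
  by congr locint; apply/funext => s; rewrite [in RHS]itg_swap.
move=> a b; apply/integrable_mkcond; first exact: measurable_itv.
apply: (@eq_integrable _ _ _ _ _ measurableT (fun s =>
  \int[mu]_x restr F a b c d (s, x))%E).
  by move=> s _; exact: restr1.
exact: (integrable_fubini_F (restr_int a b c d iF)).
Qed.

Lemma locint2_itg2 F a b : locint2 F -> locint (fun x => itg (F ^~ x) a b).
Proof.
move=> iF; wlog ab : a b / a <= b => [H|].
  have [/H//|/ltW/H/locintN] := leP a b.
  by congr locint; apply/funext => s; rewrite [in RHS]itg_swap.
move=> c d; apply/integrable_mkcond; first exact: measurable_itv.
apply: (@eq_integrable _ _ _ _ _ measurableT (fun x =>
  \int[mu]_s restr F a b c d (s, x))%E).
  by move=> s _; exact: restr2.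
rewrite (_ : (fun x => _) = fun x => \int[mu]_s restr (fun x s =>
  F s x) c d a b (x, s))%E.
  exact: (integrable_fubini_F (restr_int c d a b (locint2_flip iF))).
apply/funext => x; apply: eq_integral => s _; exact: restr_flip.
Qed.

Lemma itg_fubini F a b c d : locint2 F ->
  itg (fun s => itg (F s) c d) a b = itg (fun x => itg (F ^~ x) a b) c d.
Proof.
move=> iF; wlog cd : c d / c <= d => [H|].
  have [/H//|/ltW/H] := leP c d.
  rewrite (itg_swap _ c d) => /(congr1 (@GRing.opp _)); rewrite opprK => <-.
  rewrite -itgN//; last exact: locint2_itg1.
  by congr itg; apply/funext => s; rewrite -itg_swap.
wlog ab : a b / a <= b => [H|].
  have [/H//|/ltW/H] := leP a b.
  rewrite (itg_swap _ a b) => /(congr1 (@GRing.opp _)); rewrite opprK => ->.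
  rewrite -itgN//; last exact: locint2_itg2.
  by congr itg; apply/funext => s; rewrite -itg_swap.
rewrite (itgE _ ab) (itgE _ cd); congr fine.
rewrite [LHS]integral_mkcond [RHS]integral_mkcond.
transitivity (\int[mu]_s \int[mu]_x restr F a b c d (s, x))%E.
  by apply: eq_integral => s _; rewrite restr1.
rewrite Fubini; last exact: restr_int.
by apply: eq_integral => s _; rewrite restr2.
Qed.

(** Tonelli: a locally integrable majorant [K] of the L^1 norms of the sections bounds the double
    integral of the absolute value over a box. *)
Lemma locint2_dom F :
  measurable_fun (setT : set (RM * RM)) (fun z => F z.1 z.2 : R) ->
  (forall s, locint (F s)) -> (forall x, locint (F ^~ x)) ->
  (forall a b c d, c <= d -> exists2 K, locint K &
    forall s, a <= s <= b -> itg (fun x => `|F s x|) c d <= K s) ->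
  locint2 F.
Proof.
move=> mF F1 F2 dom; split => // a b c d.
apply/integrable_mkcond; first exact: measurableX.
have mr : measurable_fun setT (restr F a b c d).
  apply/(measurable_restrictT _ _).1 => //; first exact: measurableX.
  by apply: measurable_funTS; exact/measurable_EFinP.
apply/integrable12ltyP => //.
have [cd|dc] := leP c d; last first.
  rewrite integral0_eq// => s _; apply: integral0_eq => x _.
  rewrite /restr patchE ifF ?abse0//; apply/negP; rewrite inE => -[_ /=].
  by rewrite in_itv/= => /andP[/le_trans h /h]; rewrite leNgt dc.
have [K lK FK] := dom a b c d cd.
have /integrableP[mK] := lK a b; apply: le_lt_trans.
rewrite [leRHS]integral_mkcond.
apply: ge0_le_integral => //.
- by move=> s _; exact: integral_ge0.
- apply: (@measurable_fun_fubini_tonelli_F _ _ RM RM R mu (abse \o restr F a b c d)) =>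
  //.
  + by apply: measurableT_comp.
  + by move=> z; exact: abse_ge0.
- by apply/(measurable_restrictT _ _).1 => //; apply: measurableT_comp.
- move=> s _.
  rewrite patchE; case: ifPn => [|/negP] sab; last first.
    rewrite integral0_eq// => x _; rewrite /restr patchE ifF ?abse0//.
    by apply/negP; rewrite inE => -[/= sab' _]; apply: sab; rewrite inE.
  apply: (@le_trans _ _ (itg (fun x => `|F s x|) c d)%:E); last first.
    by rewrite /= lee_fin (le_trans (FK s _))// ?ler_norm//; move: sab;
      rewrite inE/= in_itv.
  rewrite itgE// fineK; last first.
    by apply: integrable_fin_num => //; exact: locint_norm.
  rewrite [leRHS]integral_mkcond le_eqVlt; apply/orP; left; apply/eqP.
  apply: eq_integral => x _; rewrite /restr !patchE.
  rewrite (_ : ((s, x) \in _) = (x \in `[c, d]%classic)); first by case: ifP;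
    rewrite ?abse0.
  by apply/idP/idP; rewrite !inE/=; [case|split => //]; rewrite inE in sab.
Qed.

End locint2.

(** * Absolutely continuous functions and integration by parts *)

Section prim.
Context {R : realType}.
Notation mu := (@lebesgue_measure R).
Notation RM := (measurableTypeR R).
Implicit Types (f g u n : R -> R) (a b c : R).

Lemma continuous_bounded_itv f a b : continuous f ->
  exists2 M, 0 <= M & forall x, a <= x <= b -> `|f x| <= M.
Proof.
move=> cf.
have /compact_bounded[M [_ Mf]] := continuous_compact
  (continuous_subspaceT cf) (@segment_compact R a b).
exists (`|M| + 1); first by rewrite addr_ge0.
move=> x xab; apply: (Mf (`|M| + 1)); last by exists x.
by rewrite (le_lt_trans (ler_norm _))// ltrDl.
Qed.

Lemma continuous_measurableR f : continuous f -> measurable_fun (setT : set RM) f.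
Proof. exact: continuous_measurable_fun. Qed.

Lemma locintM f g : continuous f -> locint g -> locint (fun x => f x * g x).
Proof.
move=> cf lg a b.
have [M M0 Mf] := continuous_bounded_itv a b cf.
have mf : measurable_fun (`[a, b] : set RM) f.
  by apply: measurable_funTS; exact: continuous_measurableR.
have bf : [bounded f x | x in `[a, b]%classic].
  exists M; split; rewrite ?num_real// => N MN x /= xab.
  by rewrite (le_trans (Mf x _))// ltW.
exact: (@integrableMr _ RM R mu _ (measurable_itv _) _ _ mf bf (lg a b)).
Qed.

(** Absolute continuity in integrated form: [u] is the continuous representative, while [g] may be
    any representative of its derivative. *)
Definition prim u g := locint g /\ forall a b, u b - u a = itg g a b.

Lemma prim_locint u g : prim u g -> locint g. Proof. by case. Qed.

Lemma primE u g a b : prim u g -> u b = u a + itg g a b.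
Proof. by case=> _ /(_ a b) <-; rewrite addrC subrK. Qed.

Lemma prim_itg g a : locint g -> prim (fun y => itg g a y) g.
Proof.
move=> lg; split => // x y; rewrite -(itg_cat a x y lg); ring.
Qed.

Lemma eq_prim u g u' g' : u =1 u' -> g =1 g' -> prim u g -> prim u' g'.
Proof. by move=> /funext <- /funext <-. Qed.

Lemma primD u g u' g' : prim u g -> prim u' g' ->
  prim (fun x => u x + u' x) (fun x => g x + g' x).
Proof.
move=> [lg ug] [lg' ug']; split; first exact: locintD.
by move=> a b; rewrite itgD// -ug -ug'; ring.
Qed.

Lemma primZ k u g : prim u g -> prim (fun x => k * u x) (fun x => k * g x).
Proof.
move=> [lg ug]; split; first exact: locintZ.
by move=> a b; rewrite itgZ// -ug; ring.
Qed.

Lemma prim_cst k : prim (fun=> k) (fun=> 0).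
Proof.
split; first exact: (@continuous_locint _ (fun=> 0) (fun x => cvg_cst _)).
by move=> a b; rewrite itg_cst mul0r subrr.
Qed.

Lemma prim_continuous u g : prim u g -> continuous u.
Proof.
move=> pu x; have lg := prim_locint pu.
have -> : u = fun y => u (x - 1) + itg g (x - 1) y.
  by apply/funext => y; rewrite -(primE _ _ pu).
apply: cvgD; first exact: cvg_cst.
have xx : x - 1 < x + 1 by lra.
have := parameterized_integral_continuous (ltW xx) (lg _ _).
move=> /(continuous_within_itvP _ xx)[cint _ _].
have xin : x \in `]x - 1, x + 1[ by rewrite in_itv/=; apply/andP; split; lra.
have cx := cint x xin.
rewrite itgE; last lra.
apply: cvg_trans _ cx; apply: near_eq_cvg; near=> y.
rewrite itgE//; near: y; exists 1 => //= z.
by rewrite /ball_/= ltr_norml => /andP[_ ?]; lra.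
Unshelve. all: by end_near. Qed.

Definition is_sign (s : R) := s = 1 \/ s = -1.

Lemma is_sign_sqr s : is_sign s -> s * s = 1.
Proof. by case=> ->; ring. Qed.

Lemma locint_ray s t g : is_sign s -> locint g -> locint (fun x => g (t + s * x)).
Proof.
case=> -> lg.
- have := locint_shift t lg; congr locint.
  by apply/funext => x; rewrite mul1r addrC.
- have := locint_refl t lg; congr locint.
  by apply/funext => x; rewrite mulN1r.
Qed.

Lemma itg_ray s t g a b : is_sign s -> locint g ->
  itg (fun x => g (t + s * x)) a b = s * itg g (t + s * a) (t + s * b).
Proof.
case=> -> lg.
- rewrite !mul1r (addrC t) (addrC t) -itg_shift//; congr itg.
  by apply/funext => x; rewrite mul1r addrC.
- rewrite !mulN1r -itg_swap -itg_refl//; congr itg.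
  by apply/funext => x; rewrite mulN1r.
Qed.

Lemma prim_ray s t u g : is_sign s -> prim u g ->
  prim (fun x => u (t + s * x)) (fun x => s * g (t + s * x)).
Proof.
move=> hs [lg ug]; split; first exact/locintZ/locint_ray.
move=> a b; rewrite itgZ; last exact: locint_ray.
by rewrite itg_ray// mulrA is_sign_sqr// mul1r -ug.
Qed.

Lemma prim_shift t u g : prim u g -> prim (fun x => u (x + t)) (fun x => g (x + t)).
Proof.
move=> /(@prim_ray 1 t _ _ (or_introl erefl)); apply: eq_prim => x /=.
  by rewrite mul1r addrC.
by rewrite !mul1r addrC.
Qed.

(** Differentiation under the integral sign; in integrated form it is an exchange of two
    integrals. *)
Lemma prim_fubini (W u : R -> R -> R) a b :
  (forall s, prim (W s) (u s)) -> (forall x, locint (W ^~ x)) -> locint2 u ->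
  prim (fun x => itg (W ^~ x) a b) (fun x => itg (u ^~ x) a b).
Proof.
move=> Wu lW lu; split; first exact: locint2_itg2.
move=> c d; rewrite -itg_fubini// -itgB//; congr itg.
by apply/funext => s; have [_ ->] := Wu s.
Qed.

Lemma measurable_fst2 f : measurable_fun (setT : set RM) f ->
  measurable_fun (setT : set (RM * RM)) (fun z => f z.1).
Proof. by move=> mf; apply: measurableT_comp mf _; exact: measurable_fst. Qed.

Lemma measurable_snd2 f : measurable_fun (setT : set RM) f ->
  measurable_fun (setT : set (RM * RM)) (fun z => f z.2).
Proof. by move=> mf; apply: measurableT_comp mf _; exact: measurable_snd. Qed.

Lemma locint_cut_le g a : locint g -> locint (fun x => if x <= a then g x else 0).
Proof.
move=> lg; apply: (@locint_le _ _ (fun x => `|g x|)); last 2 first.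
- exact: locint_norm.
- by move=> x; case: ifP; rewrite ?normr0.
- apply: measurable_fun_ifT => //; last exact: locint_measurable.
  exact: measurable_fun_ler.
Qed.

Lemma locint_cut_ge g a : locint g -> locint (fun x => if a <= x then g x else 0).
Proof.
move=> lg; apply: (@locint_le _ _ (fun x => `|g x|)); last 2 first.
- exact: locint_norm.
- by move=> x; case: ifP; rewrite ?normr0.
- apply: measurable_fun_ifT => //; last exact: locint_measurable.
  exact: measurable_fun_ler.
Qed.

(* Both sides of the integration by parts are the double integral of
   g(x) n1(y) over the triangle y <= x. *)
Lemma primM u g n n1 : prim u g -> prim n n1 ->
  prim (fun x => u x * n x) (fun x => u x * n1 x + n x * g x).
Proof.
move=> pu pn; have cu := prim_continuous pu; have cn := prim_continuous pn.
have [lg ug] := pu; have [ln nn] := pn.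
have l1 : locint (fun x => u x * n1 x) by exact: locintM.
have l2 : locint (fun x => n x * g x) by exact: locintM.
split; first exact: locintD.
move=> a b; wlog ab : a b / a <= b => [H|].
  have [/H//|/ltW/H/(congr1 -%R)] := leP a b.
  by rewrite -itg_swap opprB.
pose F x y := if y <= x then g x * n1 y else 0.
have FE1 x : F x = fun y => g x * (if y <= x then n1 y else 0).
  by apply/funext => y; rewrite /F; case: ifP; rewrite ?mulr0.
have FE2 y : F ^~ y = fun x => n1 y * (if y <= x then g x else 0).
  by apply/funext => x; rewrite /F; case: ifP; rewrite ?mulr0// mulrC.
have lF : locint2 F.
  apply: locint2_dom.
  - apply: measurable_fun_ifT => //.
      by apply: (@measurable_fun_ler _ (RM * RM)%type R setT snd fst);
        [exact: measurable_snd|exact: measurable_fst].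
    apply: measurable_funM; [apply: measurable_fst2|apply: measurable_snd2];
      exact: locint_measurable.
  - by move=> s; rewrite FE1; exact/locintZ/locint_cut_le.
  - by move=> x; rewrite FE2; exact/locintZ/locint_cut_ge.
  - move=> a' b' c d cd; exists (fun x => itg (fun y => `|n1 y|) c d * `|g x|).
      exact/locintZ/locint_norm.
    move=> s _; rewrite mulrC -itgZ; last exact: locint_norm.
    apply: le_itg => //.
    + by rewrite FE1; exact/locint_norm/locintZ/locint_cut_le.
    + exact/locintZ/locint_norm.
    + by move=> y _ _; rewrite /F; case: ifP; rewrite ?normrM// normr0 mulr_ge0.
have := itg_fubini a b a b lF.
have l3 : locint (fun x => (n x - n a) * g x).
  by apply: locintM => // x; apply: cvgB => //; [exact: cn|exact: cvg_cst].
have l4 : locint (fun y => (u b - u y) * n1 y).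
  by apply: locintM => // x; apply: cvgB => //; [exact: cvg_cst|exact: cu].
rewrite (@eq_itg _ _ (fun x => (n x - n a) * g x))//; last 2 first.
- exact: locint2_itg1.
- move=> x /ltW ax /ltW xb; rewrite FE1 itgZ; last exact: locint_cut_le.
  rewrite -(@itg_cat _ _ _ x); last exact: locint_cut_le.
  rewrite nn mulrC; congr (_ * _).
  rewrite (@eq_itg _ _ n1 a)//; [|exact: locint_cut_le|by move=> y _ /ltW ->].
  rewrite (@eq_itg _ _ (fun=> 0) x b)//; [|exact: locint_cut_le| |].
  + by rewrite itg_cst mul0r addr0.
  + exact: (prim_locint (prim_cst 0)).
  + by move=> y xy _; rewrite leNgt xy.
rewrite [RHS](@eq_itg _ _ (fun y => (u b - u y) * n1 y))//; last 2 first.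
- exact: locint2_itg2.
- move=> y /ltW ay /ltW yb; rewrite FE2 itgZ; last exact: locint_cut_ge.
  rewrite -(@itg_cat _ _ _ y); last exact: locint_cut_ge.
  rewrite ug mulrC; congr (_ * _).
  rewrite (@eq_itg _ _ g y b)//; [|exact: locint_cut_ge|by move=> x /ltW ->].
  rewrite (@eq_itg _ _ (fun=> 0) a y)//; [|exact: locint_cut_ge| |].
  + by rewrite itg_cst mul0r add0r.
  + exact: (prim_locint (prim_cst 0)).
  + by move=> x _ xy; rewrite leNgt xy.
have -> : (fun x => (n x - n a) * g x) = (fun x => n x * g x - n a * g x).
  by apply/funext => x; ring.
have -> : (fun y => (u b - u y) * n1 y) = (fun y => u b * n1 y - u y * n1 y).
  by apply/funext => x; ring.
have lag : locint (fun x => n a * g x) by exact: locintZ.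
have lbn : locint (fun x => u b * n1 x) by exact: locintZ.
rewrite !itgB// !itgZ// itgD// -ug -nn => E.
nra.
Qed.

End prim.

(** * Locally square integrable functions and continuity of translations *)

Section locsq.
Context {R : realType}.
Notation mu := (@lebesgue_measure R).
Notation RM := (measurableTypeR R).
Implicit Types (f g u n : R -> R) (a b c : R).

Definition locsq f :=
  measurable_fun (setT : set RM) f /\ locint (fun x => f x ^+ 2).

Lemma locint_cst k : locint (fun=> k : R).
Proof. by apply: continuous_locint => x; exact: cvg_cst. Qed.

Lemma locsq_locint f : locsq f -> locint f.
Proof.
move=> [mf lf]; apply: (@locint_le _ _ (fun x => 1 + f x ^+ 2)) => //.
  by apply: locintD => //; exact: locint_cst.
move=> x; rewrite -[X in _ + X]real_normK ?num_real//.
by have := normr_ge0 (f x); nra.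
Qed.

Lemma locsq_mul f g : locsq f -> locsq g -> locint (fun x => f x * g x).
Proof.
move=> [mf lf] [mg lg]; apply: (@locint_le _ _ (fun x => f x ^+ 2 + g x ^+ 2)).
- exact: measurable_funM.
- exact: locintD.
- move=> x; rewrite normrM -[X in _ <= X + _]real_normK ?num_real//.
  rewrite -[X in _ <= _ + X]real_normK ?num_real//.
  have := normr_ge0 (f x); have := normr_ge0 (g x) => *; nra.
Qed.

Lemma locsqD f g : locsq f -> locsq g -> locsq (fun x => f x + g x).
Proof.
move=> lf lg; have [mf lf2] := lf; have [mg lg2] := lg.
split; first exact: measurable_funD.
have := locintD (locintD lf2 lg2) (locintZ 2 (locsq_mul lf lg)).
by congr locint; apply/funext => x; ring.
Qed.

Lemma continuous_locsqM f g : continuous f -> locsq g -> locsq (fun x => f x * g x).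
Proof.
move=> cf [mg lg2]; split.
  by apply: measurable_funM => //; exact: continuous_measurableR.
have := @locintM _ (fun x => f x * f x) (fun x => g x ^+ 2) _ lg2.
move=> h; have /h : continuous (fun x => f x * f x) by move=> x;
  exact: (cvgM (cf x) (cf x)).
by congr locint; apply/funext => x; ring.
Qed.

Lemma locsqZ k f : locsq f -> locsq (fun x => k * f x).
Proof. by apply: continuous_locsqM => x; exact: cvg_cst. Qed.

Lemma locsqN f : locsq f -> locsq (fun x => - f x).
Proof. by move=> /(locsqZ (-1)); congr locsq; apply/funext => x; ring. Qed.

Lemma locsqB f g : locsq f -> locsq g -> locsq (fun x => f x - g x).
Proof. by move=> lf /locsqN; exact: locsqD. Qed.

Lemma continuous_locsq f : continuous f -> locsq f.
Proof.
move=> cf; split; first exact: continuous_measurableR.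
by apply: (@locintM _ f f) => //; exact: continuous_locint.
Qed.

Lemma locsq_cst k : locsq (fun=> k : R).
Proof. by apply: continuous_locsq => x; exact: cvg_cst. Qed.

Lemma measurable_ray s t f : measurable_fun (setT : set RM) f ->
  measurable_fun (setT : set RM) (fun x => f (t + s * x)).
Proof.
move=> mf; apply: measurableT_comp => //.
by apply: measurable_funD => //; exact: measurable_funM.
Qed.

Lemma locsq_ray s t f : is_sign s -> locsq f -> locsq (fun x => f (t + s * x)).
Proof.
by move=> hs [mf lf]; split; [exact: measurable_ray|exact: (locint_ray t hs lf)].
Qed.

Lemma locsq_if f g a : locsq f -> locsq g ->
  locsq (fun x => if x < a then f x else g x).
Proof.
move=> [mf lf] [mg lg].
have mh : measurable_fun (setT : set RM) (fun x => if x < a then f x else g x).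
  by apply: measurable_fun_ifT => //; exact: measurable_fun_ltr.
split => //; apply: (@locint_le _ _ (fun x => f x ^+ 2 + g x ^+ 2)).
- exact: measurable_funX.
- exact: locintD.
- move=> x; rewrite ger0_norm ?sqr_ge0//.
  by case: ifP => _; rewrite ?lerDl ?lerDr sqr_ge0.
Qed.

(** Cauchy-Schwarz against the constant 1, obtained by integrating [(g - m)^2 >= 0] with [m] the
    mean of [g]. *)
Lemma itg_sqr_le g a b : a <= b -> locsq g ->
  (itg g a b) ^+ 2 <= (b - a) * itg (fun x => g x ^+ 2) a b.
Proof.
rewrite le_eqVlt => /predU1P[<-|ab lg]; first by rewrite !itgxx expr0n mulr0.
pose m := itg g a b / (b - a).
have ba : 0 < b - a by rewrite subr_gt0.
have lg1 := locsq_locint lg.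
have : itg (fun x => 2 * m * g x - m ^+ 2) a b <= itg (fun x => g x ^+ 2) a b.
  apply: le_itg; [|exact: lg.2|exact: ltW|].
    by apply: locintB; [exact: locintZ|exact: locint_cst].
  by move=> x _ _; have := sqr_ge0 (g x - m); lra.
rewrite itgB; [|exact: locintZ|exact: locint_cst].
rewrite itgZ// itg_cst => h.
have E : itg g a b = m * (b - a) by rewrite /m mulrVK// unitfE gt_eqF.
move: h; rewrite E => h; nra.
Qed.

(** Dominated convergence: for [|h| < 1] the integrand is at most [2 * M], with [M] a bound of [|g|]
    on the segment enlarged by 1 on both sides. *)
Lemma continuous_shift_L1 g a b : a <= b -> continuous g ->
  itg (fun y => `|g (y + h) - g y|) a b @[h --> 0] --> 0.
Proof.
move=> ab cg.
have [M M0 Mg] := continuous_bounded_itv (a - 1) (b + 1) cg.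
pose f h y := `|g (y + h) - g y|.
have cf h : continuous (f h).
  move=> y; apply: cvg_norm; apply: cvgB; last exact: cg.
  apply: (@cvg_comp _ _ _ (fun y => y + h) g _ (nbhs (y + h))); last exact: cg.
  by apply: cvgD; [exact: cvg_id|exact: cvg_cst].
have : {in (`]-1, 1[%classic : set R), continuous (fun h =>
  \int[mu]_(y in `[a, b]) f h y)}.
  apply: (@continuity_under_integral _ _ _ mu f `[a,
    b]%classic (measurable_itv _) (-1) 1 _ _ (fun=> 2 * M)).
  - by move=> h _; exact: continuous_locint.
  - apply: aeW => y _ h _; apply: cvg_norm; apply: cvgB; last exact: cvg_cst.
    apply: (@cvg_comp _ _ _ (fun h => y + h) g _ (nbhs (y + h))); last exact: cg.
    by apply: cvgD; [exact: cvg_cst|exact: cvg_id].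
  - exact: locint_cst.
  - move=> h /=; rewrite in_itv/= => /andP[h1 h2]; apply: aeW => y /=.
    rewrite in_itv/= => /andP[y1 y2]; rewrite normr_id (le_trans (ler_normB _ _))//.
    have -> : 2 * M = M + M by ring.
    by apply: lerD; apply: Mg; apply/andP; split; lra.
move=> /(_ 0); rewrite inE/= in_itv/= ltrN10 ltr01 => /(_ isT).
rewrite /continuous_at.
have -> : \int[mu]_(y in `[a, b]) f 0 y = 0.
  rewrite -itgE// (_ : f 0 = fun=> 0) ?itg_cst ?mul0r//.
  by apply/funext => y; rewrite /f addr0 subrr normr0.
apply: cvg_trans; apply: near_eq_cvg; near=> h.
by rewrite itgE.
Unshelve. all: by end_near. Qed.

(** Density of continuous functions in L^1. The approximation is made on [[a - 1, b + 1]], so that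
    it also controls the shifted difference when [|h| <= 1]; each of the three errors is then at
    most [e / 4]. *)
Lemma shift_L1 f a b : a <= b -> locint f ->
  itg (fun y => `|f (y + h) - f y|) a b @[h --> 0] --> 0.
Proof.
move=> ab lf.
have mE : measurable (`[a - 1, b + 1]%classic : set RM) by exact: measurable_itv.
have Efin : (mu `[(a - 1)%R, (b + 1)%R]%classic < +oo)%E.
  by rewrite lebesgue_measure_itv/=; case: ifP => // _; rewrite -EFinB ltry.
have [g_ [cg ig gf]] := approximation_continuous_integrable mE Efin (lf _ _).
apply/cvgrPdist_le => e e0.
have e40 : 0 < e / 4 by rewrite divr_gt0.
have [g cgn fge] : exists2 g, continuous g &
    itg (fun y => `|f y - g y|) (a - 1) (b + 1) <= e / 4.
  have /fine_cvgP[_ /cvgrPdist_le/(_ _ e40)[N _ /(_ N (leqnn N))]] := gf.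
  rewrite /= sub0r normrN => H; exists (g_ N) => //.
  rewrite itgE; last lra.
  exact: le_trans (ler_norm _) H.
have lg := continuous_locint cgn.
have lfg : locint (fun y => `|f y - g y|) by apply: locint_norm; exact: locintB.
have fg_sub c d : a - 1 <= c -> c <= d -> d <= b + 1 ->
    itg (fun y => `|f y - g y|) c d <= e / 4.
  move=> ac cd db; apply: le_trans fge.
  have := itg_cat (a - 1) c (b + 1) lfg; have := itg_cat c d (b + 1) lfg.
  have := @itg_ge0 _ (fun y => `|f y - g y|) _ _ ac (fun _ _ _ => normr_ge0 _).
  have := @itg_ge0 _ (fun y => `|f y - g y|) _ _ db (fun _ _ _ => normr_ge0 _).
  clear; lra.
have /cvgrPdist_le/(_ _ e40) gh := continuous_shift_L1 ab cgn.
near=> h.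
rewrite sub0r normrN ger0_norm; last exact: itg_ge0.
have h1 : `|h| <= 1.
  near: h; exists 1 => //= z; rewrite /ball_/= sub0r normrN; exact: ltW.
have [h11 h12] : -1 <= h /\ h <= 1 by move: h1; rewrite ler_norml => /andP[].
have lfh := locint_shift h lf; have lgh := locint_shift h lg.
have lfgh : locint (fun y => `|f (y + h) - g (y + h)|).
  by apply: locint_norm; exact: locintB.
have lggh : locint (fun y => `|g (y + h) - g y|).
  by apply: locint_norm; exact: locintB.
have : itg (fun y => `|f (y + h) - f y|) a b <=
    itg (fun y => `|f (y + h) - g (y + h)| + (`|g (y + h) - g y| + `|f y - g y|)) a b.
  apply: le_itg => //.
  - by apply: locint_norm; exact: locintB.
  - by apply: locintD => //; exact: locintD.
  - move=> y _ _; rewrite (distrC (f y)).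
    have -> : f (y + h) - f y = (f (y + h) - g (y + h)) + ((g (y + h) - g y) + (g y - f
      y)) by ring.
    by rewrite (le_trans (ler_normD _ _))// lerD2l ler_normD.
rewrite itgD//; last exact: locintD.
rewrite itgD// => /le_trans; apply.
rewrite (@itg_shift _ (fun y => `|f y - g y|) h)//.
have := fg_sub (a + h) (b + h); have := fg_sub a b.
have : itg (fun y => `|g (y + h) - g y|) a b <= e / 4.
  rewrite (le_trans (ler_norm _))// -normrN -sub0r.
  by near: h.
move=> A B C.
have [p1 p2 p3] : [/\ a - 1 <= a, b <= b + 1 & a - 1 <= a + h].
  by split; clear - h11 h12; lra.
have [p4 p5] : a + h <= b + h /\ b + h <= b + 1 by rewrite lerD2r lerD2l.
have A1 := B p1 ab p2.
have A2 := C p3 p4 p5.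
by clear - A A1 A2 e0; lra.
Unshelve. all: by end_near. Qed.

(** The signed square [x |x|] carries L^2 to L^1, so this bound reduces continuity of translations
    in L^2 to the case of L^1. For equal signs, [|x^2 - y^2| = |x - y| |x + y| >= (x - y)^2]; for
    opposite signs, the factor 2 comes from [(x - y)^2 <= 2 (x^2 + y^2)]. *)
Lemma sqr_dist_le (x y : R) : (x - y) ^+ 2 <= 2 * `|x * `|x| - y * `|y| |.
Proof.
have H (z : R) : x * `|x| - y * `|y| <= z -> y * `|y| - x * `|x| <= z ->
    (x - y) ^+ 2 <= 2 * z.
  have [x0|/ltW x0] := leP 0 x; have [y0|/ltW y0] := leP 0 y => h1 h2;
    have [xy|/ltW xy] := leP x y;
    move: h1 h2; rewrite ?(ger0_norm x0) ?(ger0_norm y0) ?(ler0_norm x0) ?(ler0_norm y0).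
  - by have := mulr_ge0 x0 (_ : 0 <= y - x); rewrite subr_ge0 => /(_ xy); nra.
  - by have := mulr_ge0 y0 (_ : 0 <= x - y); rewrite subr_ge0 => /(_ xy); nra.
  - by have := sqr_ge0 (x + y); nra.
  - by have := sqr_ge0 (x + y); nra.
  - by have := sqr_ge0 (x + y); nra.
  - by have := sqr_ge0 (x + y); nra.
  - have y0' : 0 <= - y by rewrite oppr_ge0.
    by have := mulr_ge0 y0' (_ : 0 <= y - x); rewrite subr_ge0 => /(_ xy); nra.
  - have x0' : 0 <= - x by rewrite oppr_ge0.
    by have := mulr_ge0 x0' (_ : 0 <= x - y); rewrite subr_ge0 => /(_ xy); nra.
apply: H; first exact: ler_norm.
by rewrite -opprB (le_trans (ler_norm _))// normrN.
Qed.

Lemma shift_L2 f a b : a <= b -> locsq f ->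
  itg (fun y => (f (y + h) - f y) ^+ 2) a b @[h --> 0] --> 0.
Proof.
move=> ab lf; have [mf lf2] := lf.
pose k y := f y * `|f y|.
have lk : locint k.
  apply: (@locint_le _ _ (fun y => f y ^+ 2)) => //.
    by apply: measurable_funM => //; exact: measurableT_comp.
  by move=> x; rewrite normrM normr_id -expr2 real_normK ?num_real.
have k_le x y : (f x - f y) ^+ 2 <= 2 * `|k x - k y|.
  exact: sqr_dist_le.
have : 2 * itg (fun y => `|k (y + h) - k y|) a b @[h --> 0] --> (2 * 0 : R).
  by apply: cvgM; [exact: cvg_cst|exact: shift_L1].
rewrite mulr0.
apply: (squeeze_cvgr _ (cvg_cst 0)).
apply: nearW => h; rewrite itg_ge0//=; last by move=> *; exact: sqr_ge0.
have lkh : locint (fun y => `|k (y + h) - k y|).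
  by apply: locint_norm; apply: locintB => //; exact: locint_shift.
rewrite -itgZ//; apply: le_itg => //.
- have := @locsq_ray 1 h _ (or_introl erefl) lf => lfh.
  have [_] := locsqB lfh lf; congr locint.
  by apply/funext => x; rewrite mul1r (addrC h).
- exact: locintZ.
Qed.

End locsq.

(** * Square-integrable families and waves *)

Section families.
Context {R : realType}.
Notation RM := (measurableTypeR R).
Implicit Types (f g u m n : R -> R) (F W v : R -> R -> R) (a b c d : R).

(** Locally bounded in time with values in L^2 of space, together with square integrability in time
    at every fixed [x], which is what gives a meaning to traces and fluxes. *)
Record locsq2 F : Prop := Locsq2 {
  locsq2_measurable :
    measurable_fun (setT : set (RM * RM)) (fun z => F z.1 z.2 : R);
  locsq2_sec1 : forall s, locsq (F s);
  locsq2_sec2 : forall x, locsq (F ^~ x);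
  locsq2_bound : forall a b c d, c <= d -> exists C, forall s,
    a <= s <= b -> itg (fun x => F s x ^+ 2) c d <= C }.

Lemma locsq2_locint2 F : locsq2 F -> locint2 F.
Proof.
move=> [mF F1 F2 Fb]; apply: locint2_dom => //.
- by move=> s; exact: locsq_locint.
- by move=> x; exact: locsq_locint.
- move=> a b c d cd; have [C FC] := Fb a b c d cd.
  exists (fun=> 1 * (d - c) + C); first exact: locint_cst.
  move=> s /FC FsC; have lF := (F1 s).2.
  apply: (@le_trans _ _ (1 * (d - c) + itg (fun x => F s x ^+ 2) c d)).
    rewrite -itg_cst -itgD//; last exact: locint_cst.
    apply: le_itg => //.
    + exact/locint_norm/locsq_locint.
    + by apply: locintD => //; exact: locint_cst.
    + move=> x _ _; rewrite -[X in _ <= _ + X]real_normK ?num_real//.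
      by have := normr_ge0 (F s x); nra.
  by rewrite lerD2l.
Qed.

Lemma locsq2_sqr F : locsq2 F -> locint2 (fun s x => F s x ^+ 2).
Proof.
move=> [mF F1 F2 Fb]; apply: locint2_dom => //.
- exact: measurable_funX.
- by move=> s; have [] := F1 s.
- by move=> x; have [] := F2 x.
- move=> a b c d cd; have [C FC] := Fb a b c d cd.
  exists (fun=> C); first exact: locint_cst.
  move=> s /FC; congr (itg _ c d <= C).
  by apply/funext => x; rewrite ger0_norm// sqr_ge0.
Qed.

Lemma itg_sqrD_le f g a b : a <= b -> locsq f -> locsq g ->
  itg (fun x => (f x + g x) ^+ 2) a b <=
  2 * (itg (fun x => f x ^+ 2) a b + itg (fun x => g x ^+ 2) a b).
Proof.
move=> ab lf lg; have [_ lf2] := lf; have [_ lg2] := lg.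
rewrite -itgD// -itgZ; last exact: locintD.
apply: le_itg => //.
- by have [] := locsqD lf lg.
- by apply: locintZ; exact: locintD.
- by move=> x _ _; have := sqr_ge0 (f x - g x); lra.
Qed.

Lemma itg_sqrM_le m f a b M : a <= b -> continuous m -> locsq f ->
  (forall x, a <= x <= b -> `|m x| <= M) ->
  itg (fun x => (m x * f x) ^+ 2) a b <= M ^+ 2 * itg (fun x => f x ^+ 2) a b.
Proof.
move=> ab cm lf mM; have [_ lf2] := lf.
rewrite -itgZ//; apply: le_itg => //.
- by have [] := continuous_locsqM cm lf.
- exact: locintZ.
- move=> x ax xb; rewrite exprMn ler_wpM2r ?sqr_ge0// -[leLHS]real_normK ?num_real//.
  have mxM : `|m x| <= M by apply: mM; rewrite ax.
  by rewrite lerXn2r// nnegrE// (le_trans _ mxM).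
Qed.

Lemma locsq2D F W : locsq2 F -> locsq2 W -> locsq2 (fun s x => F s x + W s x).
Proof.
move=> [mF F1 F2 Fb] [mW W1 W2 Wb]; split.
- exact: measurable_funD.
- by move=> s; exact: locsqD.
- by move=> s; exact: locsqD.
- move=> a b c d cd; have [C FC] := Fb a b c d cd; have [C' WC] := Wb a b c d cd.
  exists (2 * (C + C')) => s sab.
  apply: (le_trans (itg_sqrD_le cd (F1 s) (W1 s))).
  by rewrite ler_pM2l// lerD ?FC ?WC.
Qed.

Lemma locsq2M m n F : continuous m -> continuous n -> locsq2 F ->
  locsq2 (fun s x => m s * n x * F s x).
Proof.
move=> cm cn [mF F1 F2 Fb].
have cmn s : continuous (fun x => m s * n x).
  by move=> x; apply: cvgM; [exact: cvg_cst|exact: cn].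
split.
- apply: measurable_funM => //; apply: measurable_funM.
    by apply: measurable_fst2; exact: continuous_measurableR.
  by apply: measurable_snd2; exact: continuous_measurableR.
- by move=> s; exact: continuous_locsqM.
- move=> x; apply: (@continuous_locsqM _ (fun s => m s * n x)) => // s.
  by apply: cvgM; [exact: cm|exact: cvg_cst].
- move=> a b c d cd; have [C FC] := Fb a b c d cd.
  have [M M0 mM] := continuous_bounded_itv a b cm.
  have [N N0 nN] := continuous_bounded_itv c d cn.
  exists ((M * N) ^+ 2 * C) => s sab.
  apply: le_trans (_ : (M * N) ^+ 2 * itg (fun x => F s x ^+ 2) c d <= _); last first.
    by rewrite ler_wpM2l ?sqr_ge0// FC.
  apply: itg_sqrM_le => // x xcd.
  by rewrite normrM ler_pM// ?mM ?nN.
Qed.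

Lemma locsq2Z k F : locsq2 F -> locsq2 (fun s x => k * F s x).
Proof.
have := @locsq2M (fun=> k) (fun=> 1) F (fun x => cvg_cst _) (fun x => cvg_cst _).
by move=> h /h; congr locsq2; apply/funext => s; apply/funext => x; rewrite mulr1.
Qed.

Lemma locsq2_space g : locsq g -> locsq2 (fun _ x => g x).
Proof.
move=> lg; have [mg lg2] := lg; split => //.
- exact: measurable_snd2.
- by move=> x; exact: locsq_cst.
- by move=> a b c d cd; exists (itg (fun x => g x ^+ 2) c d).
Qed.

Lemma itg_mono f a b c d : locint f -> (forall x, 0 <= f x) ->
  a <= c -> c <= d -> d <= b -> itg f c d <= itg f a b.
Proof.
move=> lf f0 ac cd db.
have := itg_cat a c b lf; have := itg_cat c d b lf.
have := @itg_ge0 _ f _ _ ac (fun x _ _ => f0 x).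
have := @itg_ge0 _ f _ _ db (fun x _ _ => f0 x).
clear; lra.
Qed.

Lemma locsq2_ray e f : is_sign e -> locsq f -> locsq2 (fun s x => f (s + e * x)).
Proof.
move=> he lf; have [mf lf2] := lf; split.
- apply: measurableT_comp => //; apply: measurable_funD; first exact: measurable_fst.
  by apply: measurable_funM => //; exact: measurable_snd.
- by move=> s; exact: locsq_ray.
- move=> x; have := locsq_ray (e * x) (or_introl erefl : is_sign 1) lf.
  by congr locsq; apply/funext => s; rewrite mul1r addrC.
- move=> a b c d cd.
  (* For either sign [e], this segment contains all points [s + e * x] with [s] in [[a, b]] and [x]
     in [[c, d]]. *)
  exists (itg (fun y => f y ^+ 2) (a - `|c| - `|d|) (b + `|c| + `|d|)) => s /andP[sa sb].
  rewrite (@itg_ray _ e s (fun y => f y ^+ 2))//.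
  have c1 := ler_norm c; have := ler_norm (- c); rewrite normrN => c2.
  have d1 := ler_norm d; have := ler_norm (- d); rewrite normrN => d2.
  move: `|c| `|d| c1 c2 d1 d2 => c' d' *.
  case: he => ->.
    rewrite !mul1r; apply: itg_mono => //; [by move=> x; exact: sqr_ge0|lra|lra|lra].
  rewrite !mulN1r -itg_swap; apply: itg_mono => //; [by move=> x;
    exact: sqr_ge0|lra|lra|lra].
Qed.

Definition L2cont F := forall t,
  itg (fun x => (F s x - F t x) ^+ 2) 0 1 @[s --> t] --> 0.

Lemma L2contD F W : (forall s, locsq (F s)) -> (forall s, locsq (W s)) ->
  L2cont F -> L2cont W -> L2cont (fun s x => F s x + W s x).
Proof.
move=> lF lW cF cW t.
have : 2 * (itg (fun x => (F s x - F t x) ^+ 2) 0 1 +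
    itg (fun x => (W s x - W t x) ^+ 2) 0 1) @[s --> t] --> (2 * (0 + 0) : R).
  by apply: cvgM; [exact: cvg_cst|apply: cvgD; [exact: cF|exact: cW]].
rewrite addr0 mulr0; apply: (squeeze_cvgr _ (cvg_cst 0)).
apply: nearW => s; rewrite itg_ge0//=; last by move=> *; exact: sqr_ge0.
rewrite (_ : (fun x => _) = fun x => ((F s x - F t x) + (W s x - W t x)) ^+ 2).
  by apply: itg_sqrD_le => //; exact: locsqB.
by apply/funext => x; congr (_ ^+ 2); ring.
Qed.

Lemma L2contM m n F : continuous m -> continuous n -> (forall s, locsq (F s)) ->
  L2cont F -> L2cont (fun s x => m s * n x * F s x).
Proof.
move=> cm cn lF cF t.
have [N N0 nN] := continuous_bounded_itv 0 1 cn.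
have : N ^+ 2 * (2 * (m s ^+ 2 * itg (fun x => (F s x - F t x) ^+ 2) 0 1 +
    (m s - m t) ^+ 2 * itg (fun x => F t x ^+ 2) 0 1)) @[s --> t] -->
    (N ^+ 2 * (2 * (m t ^+ 2 * 0 + (m t - m t) ^+ 2 * itg (fun x =>
      F t x ^+ 2) 0 1)) : R).
  apply: cvgM; first exact: cvg_cst.
  apply: cvgM; first exact: cvg_cst.
  apply: cvgD; apply: cvgM.
  - by apply: cvgM; exact: cm.
  - exact: cF.
  - by apply: cvgM; (apply: cvgB; [exact: cm|exact: cvg_cst]).
  - exact: cvg_cst.
rewrite subrr expr0n mul0r mulr0 addr0 !mulr0.
apply: (squeeze_cvgr _ (cvg_cst 0)).
apply: nearW => s; rewrite itg_ge0//=; last by move=> *; exact: sqr_ge0.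
rewrite (_ : (fun x => _) =
  fun x => (n x * (m s * (F s x - F t x) + (m s - m t) * F t x)) ^+ 2); last first.
  by apply/funext => x; congr (_ ^+ 2); ring.
have l1 : locsq (fun x => m s * (F s x - F t x)) by apply: locsqZ; exact: locsqB.
have l2 : locsq (fun x => (m s - m t) * F t x) by apply: locsqZ.
apply: (le_trans (itg_sqrM_le ler01 cn (locsqD l1 l2) nN)).
rewrite ler_wpM2l ?sqr_ge0//; apply: (le_trans (itg_sqrD_le ler01 l1 l2)).
rewrite ler_pM2l//; apply: lerD; rewrite -itgZ.
- by apply: le_itg => // *; rewrite ?exprMn//; [exact: l1.2|apply: locintZ;
  exact: (locsqB (lF s) (lF t)).2].
- exact: (locsqB (lF s) (lF t)).2.
- by apply: le_itg => // *; rewrite ?exprMn//; [exact: l2.2|apply: locintZ;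
  exact: (lF t).2].
- exact: (lF t).2.
Qed.

(** In the variable [y = t + e x] a change of time is a translation of [f], so this is continuity of
    translations in L^2 on an interval of length 1. *)
Lemma L2cont_ray e f : is_sign e -> locsq f -> L2cont (fun s x => f (s + e * x)).
Proof.
move=> he lf t.
have ht : (s - t : R) @[s --> t] --> (0 : R).
  by rewrite -(subrr t); apply: cvgB; [exact: cvg_id|exact: cvg_cst].
have H s : itg (fun x => (f (s + e * x) - f (t + e * x)) ^+ 2) 0 1 =
    e * itg (fun y => (f (y + (s - t)) - f y) ^+ 2) t (t + e).
  have l : locint (fun y => (f (y + (s - t)) - f y) ^+ 2).
    have := locsq_ray (s - t) (or_introl erefl : is_sign 1) lf => l.
    have [_] := locsqB l lf; congr locint.
    by apply/funext => y; rewrite mul1r (addrC y).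
  have -> : itg (fun y => (f (y + (s - t)) - f y) ^+ 2) t (t + e) =
    itg (fun y => (f (y + (s - t)) - f y) ^+ 2) (t + e * 0) (t + e * 1).
    by rewrite mulr0 addr0 mulr1.
  rewrite -itg_ray//; congr itg; apply/funext => x.
  by congr ((f _ - f _) ^+ 2); ring.
under eq_fun do rewrite H.
case: he => ->.
- under eq_fun do rewrite mul1r.
  have tt : t <= t + 1 by rewrite lerDl.
  exact: (cvg_comp _ (fun h => itg (fun y => (f (y + h) - f y) ^+ 2) t (t + 1))
    ht (shift_L2 tt lf)).
- under eq_fun do rewrite mulN1r -itg_swap.
  have tt : t - 1 <= t by rewrite gerDl.
  exact: (cvg_comp _ (fun h => itg (fun y => (f (y + h) - f y) ^+ 2) (t - 1) t)
    ht (shift_L2 tt lf)).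
Qed.

(** Cauchy-Schwarz in time bounds the square by a multiple of the time integral of [F^2], which is
    locally integrable in [x] by Fubini. *)
Lemma locsq_itg F a b : locsq2 F -> locsq (fun x => itg (F ^~ x) a b).
Proof.
move=> lF; have li := locint2_itg2 a b (locsq2_locint2 lF).
have lq := locint2_itg2 a b (locsq2_sqr lF).
split; first exact: locint_measurable.
apply: (@locint_le _ _ (fun x => `|b - a| * `|itg (fun s => F s x ^+ 2) a b|)).
- by apply: measurable_funX; exact: locint_measurable.
- exact/locintZ/locint_norm.
move=> x; rewrite -normrM (ger0_norm (sqr_ge0 _)); apply: le_trans (ler_norm _).
have [ab|/ltW ab] := leP a b; first by apply: itg_sqr_le => //; exact: locsq2_sec2.
rewrite itg_swap sqrrN [X in _ <= _ * X]itg_swap mulrN -mulNr opprB.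
by apply: itg_sqr_le => //; exact: locsq2_sec2.
Qed.

(* The difference quotient minus the derivative is a time average of
   v(tau) - v(t), so Jensen and Fubini bound its norm by the modulus of
   continuity of v. *)
Lemma L2diff W v : (forall x, prim (W ^~ x) (v ^~ x)) -> locsq2 v -> L2cont v ->
  forall t, itg (fun x => ((W s x - W t x) / (s - t) - v t x) ^+ 2) 0 1 @[s -->
    t^'] --> 0.
Proof.
move=> Wv lv cv t.
pose d s x := v s x - v t x.
have ld : locsq2 d.
  have := locsq2D lv (locsq2Z (-1) (locsq2_space (locsq2_sec1 lv t))).
  by congr locsq2; apply/funext => s; apply/funext => x; rewrite mulN1r.
have ld2 := locsq2_sqr ld.
apply/cvgrPdist_le => eps eps0.
have /cvgrPdist_le/(_ _ eps0)[del /= del0 Hdel] := cv t.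
have Hd s : `|t - s| < del -> itg (fun x => d s x ^+ 2) 0 1 <= eps.
  move=> /Hdel; rewrite sub0r normrN; apply: le_trans.
  exact: ler_norm.
near=> s.
have st : s != t by near: s; exact: nbhs_dnbhs_neq.
have sd : `|t - s| < del.
  near: s; exists del => //= z ztd _; exact: ztd.
rewrite sub0r normrN ger0_norm; last first.
  by apply: itg_ge0 => // *; exact: sqr_ge0.
have st0 : s - t != 0 by rewrite subr_eq0.
have quot x : (W s x - W t x) / (s - t) - v t x = (s - t)^-1 * itg (d ^~ x) t s.
  rewrite itgB; [|exact: (Wv x).1|exact: locint_cst].
  rewrite -(Wv x).2 itg_cst; field.
  exact: st0.
have lq : locint (fun x => itg (fun tau => d tau x ^+ 2) t s).
  exact: locint2_itg2.
have K x : (itg (d ^~ x) t s) ^+ 2 <= (s - t) * itg (fun tau => d tau x ^+ 2) t s.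
  have [ts|/ltW ts] := leP t s; first by apply: itg_sqr_le => //; exact: locsq2_sec2.
  rewrite itg_swap sqrrN [X in _ <= _ * X]itg_swap mulrN -mulNr opprB.
  by apply: itg_sqr_le => //; exact: locsq2_sec2.
have qle x : ((s - t)^-1 * itg (d ^~ x) t s) ^+ 2 <=
    (s - t)^-1 * itg (fun tau => d tau x ^+ 2) t s.
  rewrite exprMn.
  have -> : (s - t)^-1 * itg (fun tau => d tau x ^+ 2) t s =
     (s - t)^-1 ^+ 2 * ((s - t) * itg (fun tau => d tau x ^+ 2) t s).
    by field.
  by rewrite ler_wpM2l ?sqr_ge0.
apply: (@le_trans _ _ (itg (fun x => (s - t)^-1 * itg (fun tau =>
  d tau x ^+ 2) t s) 0 1)).
  apply: le_itg => //; last 2 first.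
  - exact: locintZ.
  - by move=> x _ _; rewrite quot.
  - have [_] := locsqZ (s - t)^-1 (locsq_itg t s ld); congr locint.
    by apply/funext => x; rewrite quot.
rewrite itgZ// -itg_fubini//.
have lD : locint (fun tau => itg (fun x => d tau x ^+ 2) 0 1) by exact: locint2_itg1.
have avg a b : a < b -> (forall tau, a <= tau -> tau <= b -> itg (fun x =>
  d tau x ^+ 2) 0 1 <= eps) ->
  (b - a)^-1 * itg (fun tau => itg (fun x => d tau x ^+ 2) 0 1) a b <= eps.
  move=> ab H; rewrite mulrC ler_pdivrMr ?subr_gt0// -itg_cst.
  by apply: le_itg => //; [exact: locint_cst|exact: ltW].
have [ts|st'|E] := ltgtP t s; last by rewrite E eqxx in st.
- apply: avg => // tau t1 t2; apply: Hd; move: sd.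
  by rewrite !ltr_norml => /andP[? ?]; apply/andP; split; lra.
- rewrite itg_swap mulrN -mulNr -invrN opprB.
  apply: avg => // tau t1 t2; apply: Hd; move: sd.
  by rewrite !ltr_norml => /andP[? ?]; apply/andP; split; lra.
Unshelve. all: by end_near. Qed.

End families.

(** * Travelling waves multiplied by cut-offs *)

Section waves.
Context {R : realType}.
Implicit Types (f g m n : R -> R) (F W v u h : R -> R -> R) (a b c d e : R).

(* [v] and [u] are the derivatives of [W] in time and space, and the wave
   equation with source [h] is integrated in time over [0, t]. *)
Record wave W v u h : Prop := Wave {
  wave_locsq2 : locsq2 W;
  wave_locsq2t : locsq2 v;
  wave_locsq2x : locsq2 u;
  wave_locsq2h : locsq2 h;
  wave_L2cont : L2cont W;
  wave_L2contt : L2cont v;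
  wave_L2contx : L2cont u;
  wave_primt : forall x, prim (W ^~ x) (v ^~ x);
  wave_primx : forall t, prim (W t) (u t);
  wave_eqn : forall t, prim (fun x => itg (u ^~ x) 0 t)
    (fun x => v t x - v 0 x - itg (h ^~ x) 0 t) }.

Lemma locsq2_locint_sec2 F x : locsq2 F -> locint (F ^~ x).
Proof. by move=> lF; apply: locsq_locint; exact: locsq2_sec2. Qed.

Lemma waveD W v u h W' v' u' h' : wave W v u h -> wave W' v' u' h' ->
  wave (fun t x => W t x + W' t x) (fun t x => v t x + v' t x)
    (fun t x => u t x + u' t x) (fun t x => h t x + h' t x).
Proof.
move=> [lW lv lu lh cW cv cu pt px pe] [lW' lv' lu' lh' cW' cv' cu' pt' px' pe'].
split; try exact: locsq2D.
- by apply: L2contD => //; exact: locsq2_sec1.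
- by apply: L2contD => //; exact: locsq2_sec1.
- by apply: L2contD => //; exact: locsq2_sec1.
- by move=> x; exact: primD.
- by move=> t; exact: primD.
- move=> t; apply: eq_prim (primD (pe t) (pe' t)) => x /=.
    by rewrite itgD//; exact: locsq2_locint_sec2.
  rewrite itgD; [ring|exact: locsq2_locint_sec2|exact: locsq2_locint_sec2].
Qed.

Lemma L2contZ (k : R) F : (forall s, locsq (F s)) -> L2cont F -> L2cont (fun s x =>
  k * F s x).
Proof.
move=> lF; have := @L2contM _ (fun=> k) (fun=> 1) F (fun x => cvg_cst _) (fun x =>
  cvg_cst _) lF.
by move=> H /H; congr L2cont; apply/funext => s; apply/funext => x; rewrite mulr1.
Qed.

Lemma prim_locsq f g : prim f g -> locsq f.
Proof. by move=> /prim_continuous; exact: continuous_locsq. Qed.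

Record C2 m m1 m2 : Prop := MkC2 {
  C2_prim : prim m m1; C2_prim1 : prim m1 m2; C2_cont : continuous m2 }.

Lemma C2_cont0 m m1 m2 : C2 m m1 m2 -> continuous m.
Proof. by case=> /prim_continuous. Qed.

Lemma C2_cont1 m m1 m2 : C2 m m1 m2 -> continuous m1.
Proof. by case=> _ /prim_continuous. Qed.

Lemma C2_cst k : C2 (fun=> k) (fun=> 0) (fun=> 0).
Proof. by split; [exact: prim_cst|exact: prim_cst|move=> x; exact: cvg_cst]. Qed.

Section block.
Variables (m m1 m2 n n1 n2 G g : R -> R) (e : R).
Hypotheses (he : is_sign e) (hm : C2 m m1 m2) (hn : C2 n n1 n2).
Hypotheses (hG : prim G g) (lg : locsq g).

Let lG : locsq G := prim_locsq hG.
Let W t x := m t * n x * G (t + e * x).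
Let v t x := m1 t * n x * G (t + e * x) + m t * n x * g (t + e * x).
Let u t x := m t * n1 x * G (t + e * x) + e * (m t * n x * g (t + e * x)).
(** The commutator of [d_t^2 - d_x^2] with the factor [m(t) n(x)], applied to [G(t + e x)]. Since
    [e^2 = 1] the second derivatives of [G] cancel, so only [G] and [g] remain. *)
Let h t x := (m2 t * n x * G (t + e * x) + 2 * (m1 t * n x * g (t + e * x))) +
  (-1 * (m t * n2 x * G (t + e * x)) + (-2 * e) * (m t * n1 x * g (t + e * x))).

Let cm := C2_cont0 hm.
Let cm1 := C2_cont1 hm.
Let cm2 := C2_cont hm.
Let cn := C2_cont0 hn.
Let cn1 := C2_cont1 hn.
Let cn2 := C2_cont hn.

Let lGe := locsq2_ray he lG.
Let lge := locsq2_ray he lg.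

Let J k t x := itg (fun s => k s * G (s + e * x)) 0 t.
Let K k t x := itg (fun s => k s * g (s + e * x)) 0 t.

Let locint_kG (k : R -> R) x : continuous k -> locint (fun s => k s * G (s + e * x)).
Proof. by move=> ck; apply: locintM => //; exact: (locsq2_locint_sec2 x lGe). Qed.

Let locint_kg (k : R -> R) x : continuous k -> locint (fun s => k s * g (s + e * x)).
Proof. by move=> ck; apply: locintM => //; exact: (locsq2_locint_sec2 x lge). Qed.

Let cst1 : continuous ((fun=> 1) : R -> R).
Proof. by move=> x; exact: cvg_cst. Qed.

Let primJ (k : R -> R) t : continuous k -> prim (J k t) (fun x => e * K k t x).
Proof.
move=> ck.
have : prim (fun x => itg ((fun s x => k s * G (s + e * x)) ^~ x) 0 t)
    (fun x => itg ((fun s x => e * (k s * g (s + e * x))) ^~ x) 0 t).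
  apply: prim_fubini.
  - move=> s; apply: eq_prim (primZ (k s) (prim_ray s he hG)) => // x; ring.
  - by move=> x; exact: locint_kG.
  - apply: locsq2_locint2; apply: locsq2Z.
    have := locsq2M ck cst1 lge; congr locsq2.
    by apply/funext => s; apply/funext => x; rewrite mulr1.
by apply: eq_prim => // x; rewrite itgZ//; exact: locint_kg.
Qed.

(** The time integral of [u] contains [K m], whose integrand involves [g] and has no derivative in
    [x]. But [g(s + e x)] is also the derivative of [G(s + e x)] in [s]: integrating by parts in
    time leaves boundary terms and an integral [J], which [primJ] differentiates in [x]. *)
Let ibp (k k1 : R -> R) t x : prim k k1 -> continuous k1 ->
  K k t x = k t * G (t + e * x) - k 0 * G (0 + e * x) - J k1 t x.
Proof.
move=> pk ck1; have ck := prim_continuous pk.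
have [_ /(_ 0 t)] := primM pk (prim_shift (e * x) hG).
rewrite itgD; [|exact: locint_kg|]; last first.
  have := locint_kG x ck1; congr locint; apply/funext => s; exact: mulrC.
move=> ->; rewrite /J -[X in _ = _ + X - _](_ : J k1 t x = _).
  by rewrite addrK.
by congr itg; apply/funext => s; rewrite mulrC.
Qed.

Lemma wave_block : wave W v u h.
Proof.
have pm := C2_prim hm; have pm1 := C2_prim1 hm.
have pn := C2_prim hn; have pn1 := C2_prim1 hn.
have cG := L2cont_ray he lG; have cg := L2cont_ray he lg.
have sGe s := locsq2_sec1 lGe s; have sge s := locsq2_sec1 lge s.
have l1 := locsq2M cm1 cn lGe; have l2 := locsq2M cm cn lge.
have l3 := locsq2M cm cn1 lGe; have l4 := locsq2Z e l2.
have lv : locsq2 v by apply: locsq2D; exact: locsq2M.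
have lu : locsq2 u by apply: locsq2D; [|apply: locsq2Z]; exact: locsq2M.
split.
- exact: locsq2M.
- exact: lv.
- exact: lu.
- by apply: locsq2D; apply: locsq2D; first [exact: locsq2M|apply: locsq2Z;
  exact: locsq2M].
- exact: L2contM.
- exact: (L2contD (locsq2_sec1 l1) (locsq2_sec1 l2) (L2contM cm1 cn sGe cG) (L2contM cm
  cn sge cg)).
- exact: (L2contD (locsq2_sec1 l3) (locsq2_sec1 l4) (L2contM cm cn1 sGe cG)
    (L2contZ e (locsq2_sec1 l2) (L2contM cm cn sge cg))).
- move=> x; apply: eq_prim (primZ (n x) (primM pm (prim_shift (e * x) hG))) => s;
    rewrite /W /v; ring.
- move=> t; apply: eq_prim (primZ (m t) (primM pn (prim_ray t he hG))) => x;
    rewrite /W /u; ring.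
move=> t.
have E x : itg (u ^~ x) 0 t = n1 x * J m t x + e * (n x * K m t x).
  rewrite /u itgD; last 2 first.
  - have := locintZ (n1 x) (locint_kG x cm); congr locint; apply/funext => s; ring.
  - have := locintZ (e * n x) (locint_kg x cm); congr locint; apply/funext => s; ring.
  congr (_ + _).
    rewrite -itgZ; last exact: locint_kG.
    by congr itg; apply/funext => s; ring.
  rewrite mulrA -itgZ; last exact: locint_kg.
  by congr itg; apply/funext => s; ring.
have H x : itg (h ^~ x) 0 t = n x * J m2 t x + 2 * (n x * K m1 t x) -
    (n2 x * J m t x + 2 * e * (n1 x * K m t x)).
  rewrite [LHS](_ : _ = itg (fun s => (n x * (m2 s * G (s + e * x)) +
      2 * n x * (m1 s * g (s + e * x))) - (n2 x * (m s * G (s + e * x)) +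
      2 * e * n1 x * (m s * g (s + e * x)))) 0 t); last first.
    by congr itg; apply/funext => s; rewrite /h; ring.
  have i1 := locintZ (n x) (locint_kG x cm2).
  have i2 := locintZ (2 * n x) (locint_kg x cm1).
  have i3 := locintZ (n2 x) (locint_kG x cm).
  have i4 := locintZ (2 * e * n1 x) (locint_kg x cm).
  rewrite itgB; [|exact: locintD|exact: locintD].
  rewrite !itgD// !itgZ; [|exact: locint_kg|exact: locint_kG|exact: locint_kg|exact:
    locint_kG].
  by rewrite /J /K; ring.
have pJ := primJ t cm.
have pJ1 := primJ t cm1.
have pK : prim (K m t) (fun x => e * (m t * g (t + e * x) - m 0 * g (0 + e * x) - K m1
  t x)).
  have := primD (primD (primZ (m t) (prim_ray t he hG)) (primZ (- m 0) (prim_ray 0 he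
    hG)))
    (primZ (-1) pJ1).
  apply: eq_prim => x; last by ring.
  by rewrite (ibp t x pm cm1); ring.
have := primD (primM pn1 pJ) (primZ e (primM pn pK)).
apply: eq_prim => x; first by rewrite E; ring.
rewrite H (ibp t x pm1 cm2) /v.
move: (J m t x) (J m2 t x) (K m t x) (K m1 t x) => j j2 k k1.
move: (G _) (G _) (g _) (g _) => G1 G2 g1 g2.
by case: he => ->; ring.
Qed.

End block.
End waves.

(** * Weak derivatives *)

Section transfer.
Context {R : realType}.
Notation mu := (@lebesgue_measure R).
Implicit Types (f g u : R -> R) (a b c d e : R).

Lemma restr_sqr f (D : set R) : (fun x => (f \_ D) x ^+ 2) = (fun x => f x ^+ 2) \_ D.
Proof. by apply/funext => x; rewrite !patchE; case: ifP => _ //; rewrite expr0n. Qed.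

Lemma L2_locsq f : L2 f -> locsq (f \_ `]0, 1[).
Proof.
move=> Lf; split.
  by move: Lf; rewrite /L2 inE => /andP[]; rewrite inE.
move=> a b; have := Lfun2_integrable_sqr Lf.
by apply: integrableS => //; exact: measurable_itv.
Qed.

Lemma locint_restr f : locint f -> locint (f \_ `]0, 1[).
Proof.
move=> lf; apply: (@locint_le _ _ (fun x => `|f x|)).
- apply/(measurable_restrictT _ _).1; first exact: measurable_itv.
  by apply: measurable_funTS; exact: locint_measurable.
- exact: locint_norm.
- by move=> x; rewrite patchE; case: ifP => // _; rewrite normr0.
Qed.

Lemma locsq_restr f : locsq f -> locsq (f \_ `]0, 1[).
Proof.
move=> [mf lf]; split; last by rewrite restr_sqr; exact: locint_restr.
apply/(measurable_restrictT _ _).1; first exact: measurable_itv.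
exact: measurable_funTS.
Qed.

Lemma integral_restr_sqr f : locsq f ->
  (\int[mu]_x `|(EFin \o (f \_ `]0%R, 1%R[)) x| `^ 2)%E = (itg (fun x =>
    f x ^+ 2) 0 1)%:E.
Proof.
move=> [mf lf]; rewrite itg_bndoo// fineK; last first.
  apply: integrable_fin_num; first exact: measurable_itv.
  by apply: integrableS (lf 0 1) => //; exact: subset_itv_oo_cc.
rewrite [RHS]integral_mkcond; apply: eq_integral => x _.
have -> : ((EFin \o (f \_ `]0, 1[)) x = ((f \_ `]0, 1[) x)%:E)%R by [].
have -> : ((fun x => (f x ^+ 2)%:E) \_ `]0, 1[) x = (((f \_ `]0, 1[) x) ^+ 2)%:E.
  by rewrite !patchE; case: ifP => // _; rewrite expr0n.
by rewrite abse_EFin poweR_EFin powR_mulrn ?normr_ge0// real_normK// num_real.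
Qed.

Lemma L2normE f : locsq f -> L2norm f = (Num.sqrt (itg (fun x => f x ^+ 2) 0 1))%:E.
Proof.
move=> lf; rewrite /L2norm unlock integral_restr_sqr//.
rewrite poweR_EFin powR12_sqrt// itg_ge0// => x _ _; exact: sqr_ge0.
Qed.

Lemma locsq_L2 f : locsq f -> L2 f.
Proof.
move=> lf; rewrite /L2 inE; apply/andP; split; rewrite inE/=.
  exact: (locsq_restr lf).1.
rewrite /finite_norm.
by have := L2normE lf; rewrite /L2norm => ->; rewrite ltry.
Qed.

Lemma L2norm_cvg (T : Type) (A : set_system T) {FF : Filter A} (F : T -> R -> R) :
  (forall s, locsq (F s)) ->
  itg (fun x => F s x ^+ 2) 0 1 @[s --> A] --> 0 ->
  L2norm (F s) @[s --> A] --> 0%E.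
Proof.
move=> lF cF.
under eq_fun do rewrite L2normE//.
apply: cvg_EFin; first exact: nearW.
by have := cvg_comp _ _ cF (@sqrt_continuous R 0); rewrite sqrtr0.
Qed.

Lemma prim_derive u g x : prim u g -> continuous g ->
  derivable u x 1 /\ u^`()%classic x = g x.
Proof.
move=> pu cg; have lg := prim_locint pu.
have [dF F'] := @continuous_FTC1_closed _ g (x - 1) x (x + 1)
  ltac:(lra) (lg _ _) ltac:(lra) (cg x).
pose F y := \int[mu]_(t in `[x - 1, y]) g t.
have uF : {near x, (fun y => u (x - 1) + F y) =1 u}.
  near=> y; rewrite (primE (x - 1) y pu) itgE//.
  near: y; exists 1 => //= z; rewrite /ball_/= ltr_norml => /andP[_ ?]; lra.
have dF1 : derivable (fun y => u (x - 1) + F y) x 1.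
  by apply: derivableD; [exact: derivable_cst|exact: dF].
split.
  exact: (near_eq_derivable uF dF1).
rewrite derive1E -(near_eq_derive _ uF).
rewrite deriveD; [|exact: derivable_cst|exact: dF].
by rewrite derive_cst add0r -derive1E.
Unshelve. all: by end_near. Qed.

Lemma derivable_prim f : (forall x, derivable f x 1) -> continuous f^`()%classic ->
  prim f f^`()%classic.
Proof.
move=> df cf'; split; first exact: continuous_locint.
have cf : continuous f.
  by move=> x; apply: differentiable_continuous; apply/derivable1_diffP.
suff H a b : a < b -> f b - f a = itg f^`()%classic a b.
  move=> a b; have [ab|ba|<-] := ltgtP a b; first exact: H.
    by rewrite itg_swap -H// opprB.
  by rewrite subrr itgxx.
move=> ab; rewrite itgE ?(ltW ab)// /Rintegral.
have LR : derivable_oo_LRcontinuous f a b.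
  split; first by move=> x _; exact: df.
  - by apply: cvg_at_right_filter; exact: cf.
  - by apply: cvg_at_left_filter; exact: cf.
have -> := continuous_FTC2 ab (continuous_subspaceT cf') LR (fun x _ => erefl).
by rewrite -EFinB.
Qed.

Lemma test_fun0 (phi : R -> R) x : test_fun phi -> ~ (0 < x < 1) -> phi x = 0.
Proof.
move=> [_ _ supp] x01; apply/eqP/negP => /negP px.
have /supp : closure [set x | phi x != 0] x by apply: subset_closure.
by rewrite /= in_itv.
Qed.

Lemma test_fun_prim (phi : R -> R) : test_fun phi -> prim phi phi^`()%classic.
Proof. by move=> [d c _]; exact: derivable_prim. Qed.

Lemma prim_weak u g : prim u g -> weak_derivative u g.
Proof.
move=> pu phi tphi; have pphi := test_fun_prim tphi.
have cu := prim_continuous pu; have cphi := prim_continuous pphi.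
have lup : locint (fun x => u x * phi^`()%classic x).
  by apply: locintM => //; exact: prim_locint pphi.
have lpg : locint (fun x => phi x * g x).
  by apply: locintM => //; exact: prim_locint pu.
have := (primM pu pphi).2 0 1.
rewrite !(test_fun0 (phi := phi))//; last 2 first.
- by move=> /andP[]; rewrite ltxx.
- by move=> /andP[_]; rewrite ltxx.
rewrite !mulr0 subrr itgD// !itg_bndoo// => /esym/eqP.
rewrite addr_eq0 => /eqP ->; congr -%R.
by apply: eq_Rintegral => x _; rewrite mulrC.
Qed.

Lemma prim_H1 u g : prim u g -> locsq g -> H1 u.
Proof.
move=> pu lg; split.
- by apply: continuous_subspaceT; exact: prim_continuous pu.
- exact/locsq_L2/(prim_locsq pu).
- by exists g; [exact: locsq_L2|exact: prim_weak].
Qed.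

End transfer.

(** * The du Bois-Reymond lemma and the fundamental theorem of calculus in H^1 *)

Section du_bois_reymond.
Context {R : realType}.
Notation mu := (@lebesgue_measure R).
Implicit Types (f g u w : R -> R) (a b c d e : R).

(** Test functions are only C^1, so continuous hats may occur in their derivatives. The hats need no
    normalization: their mass depends on the half-width [d] alone. *)
Let tent d a x : R := Num.max 0 (d - `|x - a|).

Let continuous_max0 f : continuous f -> continuous (fun y => Num.max 0 (f y)).
Proof.
have E y : Num.max 0 y = (y + `|y|) / 2 :> R.
  have [y0|/ltW y0] := leP 0 y.
    by rewrite ger0_norm//; lra.
  by rewrite ler0_norm//; lra.
move=> cf; have -> : (fun y => Num.max 0 (f y)) = fun y => (f y + `|f y|) / 2.
  by apply/funext => y; exact: E.
move=> x; apply: cvgM; last exact: cvg_cst.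
by apply: cvgD; [exact: cf|apply: cvg_norm; exact: cf].
Qed.

Let tent_continuous d a : continuous (tent d a).
Proof.
apply: continuous_max0 => x; apply: cvgB; first exact: cvg_cst.
by apply: cvg_norm; apply: cvgB; [exact: cvg_id|exact: cvg_cst].
Qed.

Let tent_ge0 d a x : 0 <= tent d a x.
Proof. by rewrite /tent le_max lexx. Qed.

Let tent_out d a x : d <= `|x - a| -> tent d a x = 0.
Proof. by move=> h; apply/max_idPl; rewrite subr_le0. Qed.

Let itg_tent d a p q : 0 <= d -> p <= a - d -> a + d <= q ->
  itg (tent d a) p q = itg (tent d 0) (- d) d.
Proof.
move=> d0 pa aq; have lt0 := continuous_locint (@tent_continuous d 0).
have lta := continuous_locint (@tent_continuous d a).
have l0 : locint (fun=> 0 : R) by exact: locint_cst.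
have -> : itg (tent d 0) (- d) d = itg (tent d a) (a - d) (a + d).
  rewrite [RHS](_ : _ = itg (tent d a) (- d + a) (d + a)); last by congr itg; ring.
  rewrite -itg_shift//; congr itg.
  by apply/funext => x; rewrite /tent subr0 addrK.
rewrite -(itg_cat p (a - d) q)// -(itg_cat (a - d) (a + d) q)//.
rewrite (@eq_itg _ _ (fun=> 0) p)// ?(@eq_itg _ _ (fun=> 0) (a + d))//.
- by rewrite !itg_cst !mul0r add0r addr0.
- by move=> x ax _; apply: tent_out; rewrite (le_trans _ (ler_norm _)); lra.
- by move=> x _ ax; apply: tent_out; rewrite -normrN (le_trans _ (ler_norm _)); lra.
Qed.

Let tent_pos d : 0 < d -> 0 < itg (tent d 0) (- d) d.
Proof.
move=> d0; have lt0 := continuous_locint (@tent_continuous d 0).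
apply: (@lt_le_trans _ _ (itg (tent d 0) 0 (d / 2))); last first.
  apply: itg_mono => //; lra.
apply: (@lt_le_trans _ _ (itg (fun=> d / 2) 0 (d / 2))).
  by rewrite itg_cst subr0 mulr_gt0// divr_gt0.
apply: le_itg => //; [exact: locint_cst|lra|].
move=> x x0 xd; rewrite /tent subr0 ger0_norm// le_max; apply/orP; right; lra.
Qed.

(** The primitive of the difference of two hats is zero to the left of both supports, and also to
    their right because the masses are equal. *)
Let tent_test d a b : 0 < d -> 0 < a - d -> a + d < 1 -> 0 < b - d -> b + d < 1 ->
  exists2 phi, test_fun phi & phi^`()%classic = fun x => tent d a x - tent d b x.
Proof.
move=> d0 a0 a1 b0 b1.
pose k x := tent d a x - tent d b x.
have ck : continuous k by move=> x; apply: cvgB; exact: tent_continuous.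
have lk := continuous_locint ck.
have lta := continuous_locint (@tent_continuous d a).
have ltb := continuous_locint (@tent_continuous d b).
have pk := prim_itg 0 lk.
have dphi x := prim_derive x pk ck.
have phi' : (fun x => itg k 0 x)^`()%classic = k by apply/funext => x; have [] := dphi x.
exists (fun x => itg k 0 x) => //; split.
- by move=> x; have [] := dphi x.
- by rewrite phi'.
pose p := Num.min a b - d; pose q := Num.max a b + d.
have pa : p <= a - d by rewrite lerD2r ge_min lexx.
have pb : p <= b - d by rewrite lerD2r ge_min lexx orbT.
have aq : a + d <= q by rewrite lerD2r le_max lexx.
have bq : b + d <= q by rewrite lerD2r le_max lexx orbT.
have p0 : 0 < p by rewrite subr_gt0 lt_min; apply/andP; split; lra.
have q1 : q < 1 by rewrite -ltrBrDr gt_max; apply/andP; split; lra.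
apply: (@subset_trans _ `[p, q]%classic); last first.
  by move=> x /=; rewrite !in_itv/= => /andP[? ?]; apply/andP; split; lra.
rewrite [X in _ `<=` X]((closure_id _).1 _); last exact: itv_closed.
apply: closure_subset.
move=> x /= phix; rewrite in_itv/=; apply/andP; split; rewrite leNgt; apply/negP => h.
- move/negP: phix; apply; apply/eqP.
  suff H y z : y <= z -> z <= p -> itg k y z = 0.
    have [x0|/ltW x0] := leP 0 x; first by apply: H => //; exact: ltW.
    by rewrite itg_swap H ?oppr0// ltW.
  move=> yz zp; rewrite (@eq_itg _ _ (fun=> 0))//; first by rewrite itg_cst mul0r.
    exact: locint_cst.
  move=> t _ tz; rewrite /k !tent_out ?subrr// -normrN (le_trans _ (ler_norm _)); lra.
- move/negP: phix; apply; apply/eqP; rewrite itgB// !itg_tent ?subrr//; lra.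
Qed.

(** Testing with the difference of two hats shows that [w] has the same weighted average near [a] as
    near [b], which excludes [w b < w a]. Exchanging [a] and [b] gives equality. *)
Lemma constant_of_test_fun w : continuous w ->
  (forall phi, test_fun phi -> itg (fun x => w x * phi^`()%classic x) 0 1 = 0) ->
  forall a b, 0 < a -> a < 1 -> 0 < b -> b < 1 -> w a <= w b.
Proof.
move=> cw wphi a b a0 a1 b0 b1; rewrite leNgt; apply/negP => wba.
(* A third of the gap, so that [w a - e > w b + e]. *)
pose e := (w a - w b) / 3.
have e0 : 0 < e by rewrite divr_gt0// subr_gt0.
have /cvgrPdist_le/(_ _ e0)[da /= da0 Ha] := cw a.
have /cvgrPdist_le/(_ _ e0)[db /= db0 Hb] := cw b.
(* Halving makes the inequalities strict: the closed supports of the hats lie in (0, 1) and inside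
   both continuity neighbourhoods. *)
pose d := Num.min (Num.min da db) (Num.min (Num.min a (1 - a)) (Num.min b (1 - b))) / 2.
have d0 : 0 < d by rewrite divr_gt0// !lt_min; do ! (apply/andP; split); lra.
have [[dda ddb] [dd1 dd2] [dd3 dd4]] :
    [/\ d < da /\ d < db, d < a /\ d < 1 - a & d < b /\ d < 1 - b].
  have : d * 2 <= Num.min (Num.min da db) (Num.min (Num.min a (1 - a)) (Num.min b (1 -
    b))).
    by rewrite /d divfK.
  rewrite !le_min => /andP[/andP[? ?] /andP[/andP[? ?] /andP[? ?]]].
  by split; split; lra.
have [phi tphi phi'] := @tent_test d a b d0 ltac:(lra) ltac:(lra) ltac:(lra) ltac:(lra).
have cta := @tent_continuous d a; have ctb := @tent_continuous d b.
have lta := continuous_locint cta; have ltb := continuous_locint ctb.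
have lwa : locint (fun x => w x * tent d a x) by exact: locintM.
have lwb : locint (fun x => w x * tent d b x) by exact: locintM.
have := wphi _ tphi; rewrite phi'.
rewrite (_ : (fun x => _) = fun x => w x * tent d a x - w x * tent d b x); last first.
  by apply/funext => x; rewrite mulrBr.
rewrite itgB// => /eqP; rewrite subr_eq0 => /eqP E.
have cpos := tent_pos d0.
have La : (w a - e) * itg (tent d 0) (- d) d <= itg (fun x => w x * tent d a x) 0 1.
  rewrite -(@itg_tent d a 0 1)//; [|exact: ltW|lra|lra].
  rewrite -itgZ//; apply: le_itg => //; first exact: locintZ.
  move=> x _ _; have [xd|xd] := leP d `|x - a|; first by rewrite tent_out// !mulr0.
  apply: ler_wpM2r; first exact: tent_ge0.
  have : `|w a - w x| <= e.
    by apply: Ha; rewrite /ball_/= distrC (lt_trans xd).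
  by rewrite ler_norml => /andP[_ ?]; lra.
have Lb : itg (fun x => w x * tent d b x) 0 1 <= (w b + e) * itg (tent d 0) (- d) d.
  rewrite -(@itg_tent d b 0 1)//; [|exact: ltW|lra|lra].
  rewrite -itgZ//; apply: le_itg => //; first exact: locintZ.
  move=> x _ _; have [xd|xd] := leP d `|x - b|; first by rewrite tent_out// !mulr0.
  apply: ler_wpM2r; first exact: tent_ge0.
  have : `|w b - w x| <= e.
    by apply: Hb; rewrite /ball_/= distrC (lt_trans xd).
  by rewrite ler_norml => /andP[? _]; lra.
have : (w a - e) * itg (tent d 0) (- d) d <= (w b + e) * itg (tent d 0) (- d) d.
  by rewrite (le_trans La)// E.
rewrite ler_pM2r// /e; lra.
Qed.

(** The projection onto [0, 1]; composing with it extends a function continuous on [0, 1] to a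
    continuous function on the line. *)
Let clip x : R := Num.max 0 (Num.min 1 x).

Let clip_continuous : continuous clip.
Proof.
have -> : clip = fun x => Num.max 0 (1 - Num.max 0 (1 - x)).
  apply/funext => x; rewrite /clip; congr Num.max.
  have [x1|/ltW x1] := leP 1 x.
    by rewrite (max_idPl _) ?subr0//; lra.
  by rewrite (max_idPr _); [ring|lra].
apply: continuous_max0 => x; apply: cvgB; first exact: cvg_cst.
apply: (@continuous_max0 (fun x => 1 - x)) => y.
by apply: cvgB; [exact: cvg_cst|exact: cvg_id].
Qed.

Let clip_id x : 0 <= x -> x <= 1 -> clip x = x.
Proof. by move=> x0 x1; rewrite /clip (min_idPr x1) (max_idPr x0). Qed.

Lemma clip_within u : {within `[0, 1], continuous u} -> continuous (u \o clip).
Proof.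
move=> /subspace_continuousP cu x.
have c01 y : `[0, 1]%classic (clip y).
  by rewrite /= in_itv/= /clip le_max lexx /= ge_max ler01 ge_min lexx.
move=> P /(cu _ (c01 x)) H.
have H' : nbhs (clip x) (fun y => `[0, 1]%classic y -> P (u y)) by exact: H.
have := @clip_continuous x _ H'.
have sub : (fun y => `[0, 1]%classic (clip y) ->
  P (u (clip y))) `<=` ((u \o clip) @^-1` P).
  by move=> y; apply; exact: c01.
exact: (filterS sub).
Qed.

(** The difference between [u] and a primitive of [g] has weak derivative zero, hence is constant on
    (0, 1), and up to the end points by continuity. *)
Lemma H1_ftc u g : {within `[0, 1], continuous u} -> L2 g -> weak_derivative u g ->
  forall x, 0 <= x -> x <= 1 -> u x = u 0 + itg (g \_ `]0, 1[) 0 x.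
Proof.
move=> /clip_within cu /L2_locsq lg wu.
pose g0 := g \_ `]0, 1[; pose ut := u \o clip; pose p x := itg g0 0 x.
have lg0 : locint g0 by exact: locsq_locint.
have pp : prim p g0 by exact: prim_itg.
pose w x := ut x - p x.
have cp := prim_continuous pp.
have cw : continuous w by move=> x; apply: cvgB; [exact: cu|exact: cp].
have wphi phi : test_fun phi -> itg (fun x => w x * phi^`()%classic x) 0 1 = 0.
  move=> tphi; have [_ cphi' _] := tphi.
  have cphi := prim_continuous (test_fun_prim tphi).
  have l1 : locint (fun x => ut x * phi^`()%classic x).
    by apply: locintM => //; exact: continuous_locint.
  have l2 : locint (fun x => p x * phi^`()%classic x).
    by apply: locintM => //; exact: continuous_locint.
  rewrite (_ : (fun x => _) = fun x => ut x * phi^`()%classic x - p x * phi^`()%classic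
    x).
    rewrite itgB// !itg_bndoo// (prim_weak pp tphi).
    rewrite [X in X - _](_ : _ = \int[mu]_(x in `]0, 1[) (u x * phi^`()%classic x)).
      rewrite (wu _ tphi) opprK addrC; apply/eqP; rewrite subr_eq0; apply/eqP.
      by apply: eq_Rintegral => x x01; rewrite /g0 patchE x01.
    apply: eq_Rintegral => x; rewrite inE/= in_itv/= => /andP[x0 x1].
    by rewrite /ut /= clip_id// ltW.
  by apply/funext => x; rewrite /w mulrBl.
have cst a b : 0 < a -> a < 1 -> 0 < b -> b < 1 -> w a = w b.
  move=> a0 a1 b0 b1; apply/eqP; rewrite eq_le.
  by rewrite (constant_of_test_fun cw wphi)// (constant_of_test_fun cw wphi).
have cst1 x : 0 <= x -> x <= 1 -> w x = w 2^-1.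
  move=> x0 x1; apply/eqP; rewrite -subr_eq0 -normr_le0; apply/ler_addgt0Pl => e e0.
  rewrite addr0.
  have /cvgrPdist_le/(_ _ e0)[d /= d0 Hd] := cw x.
  pose s := Num.min d 2^-1.
  have s0 : 0 < s by rewrite lt_min d0 invr_gt0 ltr0n.
  have sd : s <= d by rewrite ge_min lexx.
  have s1 : s <= 2^-1 by rewrite ge_min lexx orbT.
  (* A small move towards the midpoint leads from an end point into the open interval. *)
  pose y := x + s * (2^-1 - x).
  have y0 : 0 < y by rewrite /y; nra.
  have y1 : y < 1 by rewrite /y; nra.
  have <- : w y = w 2^-1 by apply: cst => //; lra.
  apply: Hd; rewrite /ball_/= /y opprD addNKr normrN normrM gtr0_norm//.
  apply: (@le_lt_trans _ _ (s * 2^-1)); last by lra.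
  by rewrite ler_pM2l// ler_norml; apply/andP; split; lra.
move=> x x0 x1; have := cst1 x x0 x1; rewrite -(cst1 0)// /w /ut /=.
by rewrite !clip_id// /p itgxx subr0 => <-; rewrite subrK.
Qed.

End du_bois_reymond.

(** * Waves on the edges that form a solution on the graph *)

Section assembly.
Context {R : realType}.
Notation mu := (@lebesgue_measure R).
Notation RM := (measurableTypeR R).
Implicit Types (F : R -> R -> R) (a b T : R).

Lemma itg_sum n (f : 'I_n -> R -> R) a b : (forall j, locint (f j)) ->
  locint (fun s => \sum_(j < n) f j s) /\
  itg (fun s => \sum_(j < n) f j s) a b = \sum_(j < n) itg (f j) a b.
Proof.
move=> lf; elim: (index_enum 'I_n) => [|j s [ls IH]].
  rewrite big_nil; under eq_fun do rewrite big_nil.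
  by split; [exact: locint_cst|rewrite itg_cst mul0r].
rewrite big_cons; under eq_fun do rewrite big_cons.
by split; [exact: locintD|rewrite itgD// IH].
Qed.

Lemma locsq2_Lfun F (c d a b : R) : locsq2 F ->
  (fun z : R * R => F z.1 z.2) \_ (`]a, b[ `*` `]c, d[)
    \in Lfun (mu \x mu)%E 2%:E.
Proof.
move=> lF.
have mX : measurable ((`]a, b[ `*` `]c, d[) : set (RM * RM)).
  by apply: measurableX; exact: measurable_itv.
pose Fr : RM * RM -> R := (fun z : RM * RM =>
  F z.1 z.2) \_ ((`]a, b[ `*` `]c, d[) : set (RM * RM)).
have mF : measurable_fun (setT : set (RM * RM)) Fr.
  apply/(measurable_restrictT _ _).1 => //.
  by apply: measurable_funTS; exact: locsq2_measurable.
rewrite inE; apply/andP; split; rewrite inE/=; first exact: mF.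
rewrite /finite_norm unlock; apply: poweR_lty.
have := locint2_box (locsq2_sqr lF) a b c d.
move=> /(@integrableS _ _ _ _ _ ((`]a, b[ `*` `]c, d[) : set (RM * RM))).
move=> /(_ _ mX) H.
have {H} : (mu \x mu)%E.-integrable ((`]a, b[ `*` `]c, d[) : set (RM * RM))
    (fun z => (F z.1 z.2 ^+ 2)%:E).
  apply: H; first by apply: measurableX; exact: measurable_itv.
  by move=> z [/= z1 z2]; split; exact: subset_itv_oo_cc.
move=> /(integrable_mkcond _ mX)/integrableP[_]; apply: le_lt_trans.
rewrite le_eqVlt; apply/orP; left; apply/eqP; apply: eq_integral => z _.
have -> : ((EFin \o ((fun z : R * R => F z.1 z.2) \_ (`]a, b[ `*` `]c,
  d[))) z = (Fr z)%:E)%R by [].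
have -> : ((fun z : RM * RM => (F z.1 z.2 ^+ 2)%:E) \_
    ((`]a, b[ `*` `]c, d[) : set (RM * RM))) z = (Fr z ^+ 2)%:E.
  by rewrite /Fr !patchE; case: ifP => // _; rewrite expr0n.
rewrite abse_EFin poweR_EFin powR_mulrn ?normr_ge0// real_normK ?num_real//.
by rewrite abse_EFin ger0_norm// sqr_ge0.
Qed.

Lemma L2cont_within F (A : set R) t : (forall s, locsq (F s)) -> L2cont F ->
  L2norm (F s \- F t) @[s --> within A (nbhs t)] --> 0%E.
Proof.
move=> lF cF; apply: (@L2norm_cvg _ _ _ _ (fun s => F s \- F t)).
  by move=> s; exact: locsqB.
by apply: cvg_trans (cF t); apply: cvg_app; exact: cvg_within.
Qed.

Variables (T : R) (W v u h : 'I_4 -> R -> R -> R) (u0 u1 : graph_fun R).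
Hypotheses (wW : forall j, wave (W j) (v j) (u j) (h j)).
Hypothesis h_omega : forall j, j \notin omega -> forall t x, h j t x = 0.
Hypothesis W_vertex : forall t, 0 <= t <= T ->
  W e1 t 0 = W e2 t 0 /\ W e2 t 0 = W e3 t 0 /\ W e3 t 0 = W e4 t 0.
Hypothesis W_dirichlet : forall t, 0 <= t <= T -> W e3 t 1 = 0 /\ W e4 t 1 = 0.
(** The flux conditions enter the mild formulation only through their time integrals, whence the
    open time interval. *)
Hypothesis u_neumann : forall t, 0 < t < T -> u e1 t 1 = 0 /\ u e2 t 1 = 0.
Hypothesis u_kirchhoff : forall t, 0 < t < T -> \sum_(j < 4) u j t 0 = 0.
Hypothesis W_init : forall j x, 0 <= x <= 1 -> W j 0 x = u0 j x.
Hypothesis v_init : forall j x, 0 < x < 1 -> v j 0 x = u1 j x.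

Let sec1W j t : locsq (W j t). Proof. exact/locsq2_sec1/wave_locsq2. Qed.
Let sec1v j t : locsq (v j t). Proof. exact/locsq2_sec1/wave_locsq2t. Qed.
Let sec1u j t : locsq (u j t). Proof. exact/locsq2_sec1/wave_locsq2x. Qed.

Let W_H1Delta t : 0 <= t <= T -> H1Delta (fun j => W j t).
Proof.
move=> tT; split; [|exact: W_vertex|exact: W_dirichlet].
by move=> j; apply: (prim_H1 (wave_primx (wW j) t)).
Qed.

Lemma wave_L2control : L2control T (fun j z => h j z.1 z.2).
Proof. by move=> j _; apply: locsq2_Lfun; exact: wave_locsq2h. Qed.

(** The time integral of [W j] has the space derivative [D j] by Fubini, and [wave_eqn] says that
    [D j] has the derivative [f j]. The vertex conditions are linear, so they pass to time
    integrals. *)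
Lemma wave_solution_assembly :
  wave_solution T (fun j z => h j z.1 z.2) u0 u1 (fun t j => W j t) (fun t j => v j t).
Proof.
split.
- split.
  + by move=> t _; split => j; exact: locsq_L2.
  + move=> t _ j; apply: (@L2cont_within (v j)) => //; exact: wave_L2contt.
  + move=> t _ j.
    apply: (@L2norm_cvg _ _ _ _ (fun s x => (W j s x - W j t x) / (s - t) - v j t x)).
      move=> s; apply: locsqB => //.
      have := locsqZ (s - t)^-1 (locsqB (sec1W j s) (sec1W j t)).
      by congr locsq; apply/funext => x; rewrite mulrC.
    have := L2diff (wave_primt (wW j)) (wave_locsq2t (wW j)) (wave_L2contt (wW j)) t.
    by apply: cvg_trans; apply: cvg_app; exact: cvg_within.
- split; first by move=> t; rewrite in_itv/=; exact: W_H1Delta.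
  exists (fun t j => u j t).
    move=> t _ j; split; first exact: locsq_L2.
    exact: prim_weak (wave_primx (wW j) t).
  split.
  + move=> t _ j; apply: (@L2cont_within (W j)) => //; exact: wave_L2cont.
  + move=> t _ j; apply: (@L2cont_within (u j)) => //; exact: wave_L2contx.
- by move=> j x; rewrite in_itv/=; exact: W_init.
- by move=> j; apply: aeW => x; rewrite in_itv/=; exact: v_init.
move=> t; rewrite in_itv/= => /andP[t0 tT].
have tsub s : 0 < s -> s < t -> 0 < s < T by move=> s0 st; rewrite s0 (lt_le_trans st).
have tsub' s : 0 < s -> s < t -> 0 <= s <= T.
  by move=> s0 st; have /andP[/ltW -> /ltW ->] := tsub s s0 st.
have lWx j x : locint (W j ^~ x) by exact/locsq2_locint_sec2/wave_locsq2.
have lux j x : locint (u j ^~ x) by exact/locsq2_locint_sec2/wave_locsq2x.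
have lhx j x : locint (h j ^~ x) by exact/locsq2_locint_sec2/wave_locsq2h.
pose f : graph_fun R := fun j x => v j t x - v j 0 x - itg (h j ^~ x) 0 t.
pose D : graph_fun R := fun j x => itg (u j ^~ x) 0 t.
have lf j : locsq (f j).
  apply: locsqB; first exact: locsqB.
  exact/locsq_itg/wave_locsq2h.
have pD j : prim (D j) (f j) := wave_eqn (wW j) t.
have pI j : prim (fun x => itg (W j ^~ x) 0 t) (D j).
  apply: prim_fubini => //; first exact: wave_primx.
  exact/locsq2_locint2/wave_locsq2x.
exists f.
  have -> : (fun j x => \int[mu]_(s in `]0, t[) W j s x) = fun j x => itg (W j ^~ x) 0 t.
    by apply/funext => j; apply/funext => x; rewrite itg_bndoo.
  split.
    split.
    + by move=> j; exact: prim_H1 (pI j) (prim_locsq (pD j)).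
    + split; [|split]; apply: eq_itg => // s s0 st;
        by have [E1 [E2 E3]] := W_vertex (tsub' s s0 st).
    + have itg0 (k : R -> R) : locint k -> (forall s, 0 < s -> s < t -> k s = 0) ->
      itg k 0 t = 0.
        move=> lk k0; rewrite (@eq_itg _ _ (fun=> 0))//; last exact: locint_cst.
        by rewrite itg_cst mul0r.
      by split; apply: itg0 => // s s0 st; have [] := W_dirichlet (tsub' s s0 st).
  exists D; split.
  - move=> j; split; first exact: prim_weak (pI j).
    exact: prim_H1 (pD j) (lf j).
  - by move=> j; split; [exact: locsq_L2|exact: prim_weak (pD j)].
  - have [ls <-] := itg_sum 0 t (fun j => lux j 0).
    rewrite (@eq_itg _ _ (fun=> 0))//.
    + by rewrite itg_cst mul0r.
    + exact: locint_cst.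
    + by move=> s s0 st; apply: u_kirchhoff; exact: tsub.
  - split; rewrite /D (@eq_itg _ _ (fun=> 0)) ?itg_cst ?mul0r//.
    + exact: locint_cst.
    + by move=> s s0 st; have [] := u_neumann (tsub s s0 st).
    + exact: locint_cst.
    + by move=> s s0 st; have [] := u_neumann (tsub s s0 st).
move=> j; apply: aeW => x; rewrite in_itv/= => x01.
have -> : \int[mu]_(s in `]0, t[) source (fun j z =>
  h j z.1 z.2) s j x = itg (h j ^~ x) 0 t.
  rewrite itg_bndoo//; apply: eq_Rintegral => s _; rewrite /source.
  by case: ifPn => // jo; rewrite h_omega.
by rewrite /f -(v_init j x01); ring.
Qed.

End assembly.

(** * Cut-offs *)

Section cutoff.
Context {R : realType}.
Implicit Types (m f g : R -> R) (a b c d e : R).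

Lemma C2D m m1 m2 f f1 f2 : C2 m m1 m2 -> C2 f f1 f2 ->
  C2 (fun x => m x + f x) (fun x => m1 x + f1 x) (fun x => m2 x + f2 x).
Proof.
move=> [p p1 c] [q q1 d]; split; [exact: primD|exact: primD|].
by move=> x; apply: cvgD; [exact: c|exact: d].
Qed.

Lemma C2Z k m m1 m2 : C2 m m1 m2 ->
  C2 (fun x => k * m x) (fun x => k * m1 x) (fun x => k * m2 x).
Proof.
move=> [p p1 c]; split; [exact: primZ|exact: primZ|].
by move=> x; apply: cvgM; [exact: cvg_cst|exact: c].
Qed.

Lemma C2_shift t m m1 m2 : C2 m m1 m2 ->
  C2 (fun x => m (x + t)) (fun x => m1 (x + t)) (fun x => m2 (x + t)).
Proof.
move=> [p p1 c]; split; [exact: prim_shift|exact: prim_shift|].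
move=> x; apply: (@cvg_comp _ _ _ (fun y => y + t) m2 _ (nbhs (x + t))); last exact: c.
by apply: cvgD; [exact: cvg_id|exact: cvg_cst].
Qed.

Lemma C2_refl t m m1 m2 : C2 m m1 m2 ->
  C2 (fun x => m (t - x)) (fun x => - m1 (t - x)) (fun x => m2 (t - x)).
Proof.
move=> [p p1 c]; have s1 : is_sign (-1 : R) by right.
have := primZ (-1) (prim_ray t s1 p1); have := prim_ray t s1 p.
move=> q q1; split.
- by apply: eq_prim q => x; rewrite !mulN1r.
- by apply: eq_prim q1 => x; rewrite !mulN1r ?opprK.
- move=> x; apply: (@cvg_comp _ _ _ (fun y => t - y) m2 _ (nbhs (t - x))); last exact: c.
  by apply: cvgB; [exact: cvg_cst|exact: cvg_id].
Qed.

Let pos (x : R) : R := Num.max 0 x.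

Let pos_id (x : R) : 0 <= x -> pos x = x. Proof. by move=> /max_idPr. Qed.

Let pos_0 (x : R) : x <= 0 -> pos x = 0. Proof. by move=> /max_idPl. Qed.

Let step (x : R) : R := if x < 0 then 0 else 1.

Let prim_pos : prim pos step.
Proof.
have ls : locint step by apply/locsq_locint/locsq_if; exact: locsq_cst.
apply: eq_prim (prim_itg 0 ls) => // x.
have [x0|/ltW x0] := leP 0 x.
  rewrite pos_id// (@eq_itg _ _ (fun=> 1))//; first by rewrite itg_cst; ring.
    exact: locint_cst.
  by move=> y y0 _; rewrite /step ltNge ltW.
rewrite pos_0// itg_swap (@eq_itg _ _ (fun=> 0))//; first by rewrite itg_cst; ring.
  exact: locint_cst.
by move=> y _ y0; rewrite /step y0.
Qed.

Let pos_step x : pos x * step x = pos x.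
Proof.
rewrite /step; case: ltP => x0; last by rewrite mulr1.
by rewrite pos_0 ?mul0r// ltW.
Qed.

Let C2_cube : C2 (fun x => pos x ^+ 3) (fun x => 3 * pos x ^+ 2) (fun x => 6 * pos x).
Proof.
have p2 : prim (fun x => pos x ^+ 2) (fun x => 2 * pos x).
  apply: eq_prim (primM prim_pos prim_pos) => x; first by rewrite expr2.
  by rewrite pos_step; ring.
split.
- apply: eq_prim (primM prim_pos p2) => x; first by ring.
  have -> : pos x ^+ 2 * step x = pos x ^+ 2 by rewrite expr2 -mulrA pos_step.
  by ring.
- by apply: eq_prim (primZ 3 p2) => x; ring.
- by move=> x; apply: cvgM; [exact: cvg_cst|exact: prim_continuous prim_pos x].
Qed.

(* The primitive of a cubic B-spline: the third difference of a cube is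
   constant. *)
Lemma cutoff_exists a : 0 < a -> exists m m1 m2, [/\ C2 m m1 m2,
  forall x, x <= a -> m x = 1 /\ m1 x = 0 &
  forall x, 2 * a <= x -> m x = 0 /\ m1 x = 0].
Proof.
move=> a0; pose s := a / 3.
have s0 : 0 < s by rewrite divr_gt0.
have sa : a = 3 * s by rewrite /s; field.
(* The third difference of a cube with step [s] is [6 s^3]; the four knots [3 s, ..., 6 s] run from
   [a] to [2 a]. *)
pose k := - (6 * s ^+ 3)^-1.
have Q c := C2_shift (- c) C2_cube.
have H := C2D (C2_cst 1) (C2Z k (C2D (C2D (Q (3 * s)) (C2Z (-3) (Q (4 * s))))
  (C2D (C2Z 3 (Q (5 * s))) (C2Z (-1) (Q (6 * s)))))).
do 3 eexists; split; first exact: H.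
- move=> x; rewrite sa => xa /=.
  by rewrite !pos_0; [split; ring|lra|lra|lra|lra].
- move=> x; rewrite sa => xa /=.
  rewrite !pos_id; [|lra|lra|lra|lra]; rewrite /k; split; last ring.
  by field; rewrite gt_eqF.
Qed.

End cutoff.

(** * The profiles of the controlled solution *)

Section dalembert.
Context {R : realType}.
Implicit Types (g : R -> R) (a b c d e s l t x : R).

(* On an edge [0, 1] with l = 2, s = 1 reflects at x = 1 with a Neumann
   condition, s = - 1 with a Dirichlet condition. *)
Definition dal s c b l g t x := c + itg g b (t - x) + s * itg g b (t + x - l).
Definition dalt s l g t x := g (t - x) + s * g (t + x - l) : R.
Definition dalx s l g t x := - g (t - x) + s * g (t + x - l) : R.

Lemma eq_wave W v u h W' v' u' h' :
  W =2 W' -> v =2 v' -> u =2 u' -> h =2 h' -> @wave R W v u h -> wave W' v' u' h'.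
Proof.
have E F G : F =2 G -> F = G :> (R -> R -> R).
  by move=> FG; apply/funext => x; apply/funext => y.
by move=> /E <- /E <- /E <- /E <-.
Qed.

Lemma wave_dal (m m1 m2 n n1 n2 : R -> R) s c b l g :
  C2 m m1 m2 -> C2 n n1 n2 -> locsq g ->
  wave (fun t x => m t * n x * dal s c b l g t x)
    (fun t x => m1 t * n x * dal s c b l g t x + m t * n x * dalt s l g t x)
    (fun t x => m t * n1 x * dal s c b l g t x + m t * n x * dalx s l g t x)
    (fun t x => m2 t * n x * dal s c b l g t x + 2 * (m1 t * n x * dalt s l g t x)
      - m t * n2 x * dal s c b l g t x - 2 * (m t * n1 x * dalx s l g t x)).
Proof.
move=> hm hn lg; have lg1 := locsq_locint lg.
have p1 : prim (fun y => c + itg g b y) g.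
  by apply: eq_prim (primD (prim_cst c) (prim_itg b lg1)) => x; rewrite ?add0r.
have p2 : prim (fun y => s * itg g b (y - l)) (fun y => s * g (y - l)).
  by apply: primZ; exact: (prim_shift (- l) (prim_itg b lg1)).
have lg2 : locsq (fun y => s * g (y - l)).
  apply: locsqZ; have := locsq_ray (- l) (or_introl erefl : is_sign 1) lg.
  by congr locsq; apply/funext => y; rewrite mul1r addrC.
have := waveD (wave_block (or_intror erefl : is_sign (-1)) hm hn p1 lg)
  (wave_block (or_introl erefl : is_sign 1) hm hn p2 lg2).
by apply: eq_wave => t x; rewrite /dal /dalt /dalx !mul1r !mulN1r; ring.
Qed.

Lemma wave_dal1 s c b l g : locsq g ->
  wave (dal s c b l g) (dalt s l g) (dalx s l g) (fun _ _ => 0).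
Proof.
move=> lg; have := wave_dal s c b l (C2_cst 1) (C2_cst 1) lg.
by apply: eq_wave => t x; ring.
Qed.

Lemma prim_eq_on (f f' k k' : R -> R) a b d : prim f f' -> prim k k' -> a <= d <= b ->
  (forall x, a < x -> x < b -> f' x = k' x) -> f d = k d ->
  forall x, a <= x <= b -> f x = k x.
Proof.
move=> pf pk /andP[ad db] fk fkd x /andP[ax xb].
rewrite (primE d x pf) (primE d x pk) fkd; congr (_ + _).
have lf := prim_locint pf; have lk := prim_locint pk.
have [dx|/ltW dx] := leP d x.
  by apply: eq_itg => // y dy yx; apply: fk; lra.
rewrite itg_swap [RHS]itg_swap; congr (- _).
by apply: eq_itg => // y dy yx; apply: fk; lra.
Qed.

(* The profile on (-2, 0) that produces displacement with derivative [p] and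
   velocity [q] at time 0. *)
Definition profile s (p q : R -> R) y :=
  (q (- y) - p (- y)) / 2 + s * ((p (y + 2) + q (y + 2)) / 2).

Lemma locsq_profile s (p q : R -> R) : locsq p -> locsq q -> locsq (profile s p q).
Proof.
move=> lp lq; have s1 : is_sign (1 : R) by left.
have sN1 : is_sign (-1 : R) by right.
have := locsqD (locsqZ 2^-1 (locsqB (locsq_ray 0 sN1 lq) (locsq_ray 0 sN1 lp)))
  (locsqZ (s / 2) (locsqD (locsq_ray 2 s1 lp) (locsq_ray 2 s1 lq))).
congr locsq; apply/funext => y.
by rewrite /profile !mulN1r !mul1r !add0r !(addrC 2); ring.
Qed.

(** As [p] and [q] vanish off (0, 1), the two terms of [profile] live on (-1, 0) and (-2, -1):
    [g (t0 - x)] sees only the first and [g (t0 + x - 2)] only the second. Combining them gives back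
    the velocity [q] and the slope [p]. The slope leaves a constant free in the displacement, which
    is fixed at the point [x0]. *)
Lemma dal_match s c b g t0 x0 (w0 w1 p q : R -> R) : is_sign s ->
  locsq g -> locsq p ->
  (forall x, ~~ (0 < x < 1) -> p x = 0) -> (forall x, ~~ (0 < x < 1) -> q x = 0) ->
  (forall x, 0 <= x -> x <= 1 -> w0 x = w0 0 + itg p 0 x) ->
  (forall x, 0 < x < 1 -> q x = w1 x) ->
  (forall y, t0 - 2 < y < t0 -> g y = profile s p q (y - t0)) ->
  0 <= x0 <= 1 -> dal s c b 2 g t0 x0 = w0 x0 ->
  (forall x, 0 <= x <= 1 -> dal s c b 2 g t0 x = w0 x) /\
  (forall x, 0 < x < 1 -> dalt s 2 g t0 x = w1 x).
Proof.
move=> hs lg lp p0 q0 w0E qE gE x01 Ex0.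
have ss := is_sign_sqr hs.
have g1 x : 0 < x < 1 -> g (t0 - x) = (q x - p x) / 2.
  move=> /andP[x0' x1]; rewrite gE; last by lra.
  rewrite /profile (_ : t0 - x - t0 = - x); last by ring.
  rewrite opprK (p0 (- x + 2)) ?(q0 (- x + 2)).
  - by rewrite addr0 mul0r mulr0 addr0.
  - by apply/negP => /andP[? ?]; lra.
  - by apply/negP => /andP[? ?]; lra.
have g2 x : 0 < x < 1 -> g (t0 + x - 2) = s * ((p x + q x) / 2).
  move=> /andP[x0' x1]; rewrite gE; last by lra.
  rewrite /profile (_ : t0 + x - 2 - t0 = x - 2); last by ring.
  rewrite subrK (p0 (- (x - 2))) ?(q0 (- (x - 2))).
  - by rewrite subr0 mul0r add0r.
  - by apply/negP => /andP[? ?]; lra.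
  - by apply/negP => /andP[? ?]; lra.
split.
- have pw : prim (fun x => w0 0 + itg p 0 x) p.
    apply: eq_prim (primD (prim_cst (w0 0)) (prim_itg 0 (locsq_locint lp))) => x //.
    by rewrite add0r.
  have pd := wave_primx (wave_dal1 s c b 2 lg) t0.
  move=> x /andP[xa xb]; rewrite w0E//.
  apply: (prim_eq_on pd pw x01 _ _ (x := x)); last by rewrite xa.
  + move=> y ya yb; have y01 : 0 < y < 1 by rewrite ya yb.
    by rewrite /dalx g1// g2// mulrA ss; field.
  + by rewrite Ex0; case/andP: x01 => *; exact: w0E.
- by move=> x xx; rewrite /dalt g1// g2// mulrA ss -(qE x xx); field.
Qed.

End dalembert.

(** * The delay equations for the profiles *)

Section profiles.
Context {R : realType}.
Variables (T d : R) (A B : 'I_4 -> R -> R).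
Hypotheses (d0 : 0 < d) (d1 : 2 * d <= 1) (dT : 2 * d <= T - 4).
Implicit Types t : R.

Local Ltac dlra := move: (d0) (d1) (dT) => ? ? ?; lra.

Definition edge_sign (j : 'I_4) : R := if (j < 2)%N then 1 else -1.

(* The derivative of the value at the interior vertex when Kirchhoff's
   condition holds: near t = 0 in terms of the incoming waves, near t = T in
   terms of the outgoing ones. *)
Definition trace0 t := (A e1 (t - 2) + A e2 (t - 2) - A e3 (t - 2) - A e4 (t - 2)) / 2.
Definition traceT t := (B e1 t + B e2 t + B e3 t + B e4 t) / 2.

(* The outgoing profiles g2, g4 of the free edges have the same trace iff
   g2 - g4 = - (g2 + g4)(. - 2). Hence everything is given by the sum
   [sum24], which the initial data determine on (-2, d) and the final data on
   (T - 4 - d, T); between them it is arbitrary. *)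
Definition final2 t := if t < T - 2 then traceT (t + 2) - B e2 (t + 2) else B e2 t.
Definition final4 t := if t < T - 2 then B e4 (t + 2) - traceT (t + 2) else B e4 t.
(** Adding the expressions [g2 + g2(. - 2)] and [g4 - g4(. - 2)] of the trace gives
    [2 trace = (g2 + g4) + (g2 - g4)(. - 2)], whence the second branch. The fourth one is the
    relation of equal traces read at [t + 2], where the final state determines both profiles. *)
Definition sum24 t :=
  if t < 0 then A e2 t + A e4 t
  else if t < d then 2 * trace0 t - (A e2 (t - 2) - A e4 (t - 2))
  else if t < T - 4 - d then 0
  else if t < T - 2 - d then final4 (t + 2) - final2 (t + 2)
  else final2 t + final4 t.
Definition diff24 t := if t < 0 then A e2 t - A e4 t else - sum24 (t - 2).
Definition prof2 t := (diff24 t + sum24 t) / 2.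
Definition prof4 t := (sum24 t - diff24 t) / 2.
Definition trace t := prof2 t + prof2 (t - 2).

Lemma prof_init t : t < 0 -> prof2 t = A e2 t /\ prof4 t = A e4 t.
Proof. by move=> t0; rewrite /prof2 /prof4 /diff24 /sum24 t0; split; field. Qed.

Let sum24_late t : T - 2 - d <= t -> sum24 t = final2 t + final4 t.
Proof.
by move=> h; rewrite /sum24; do ! (case: ltP => ?; first dlra).
Qed.

Let sum24_mid t : T - 4 - d <= t -> t < T - 2 - d ->
  sum24 t = final4 (t + 2) - final2 (t + 2).
Proof.
move=> h1 h2; rewrite /sum24; do 3 (case: ltP => ?; first dlra).
by case: ltP => ? //; dlra.
Qed.

(** For [t >= T - d] the time [t - 2] falls into the last branch of [sum24]. There [traceT] cancels
    in [final2 + final4] and [B e4 t - B e2 t] is left, so the delay relation agrees with the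
    prescribed final profiles. *)
Let diff24_late t : T - 2 - d <= t -> t < T -> diff24 t = final2 t - final4 t.
Proof.
move=> h1 h2; rewrite /diff24 ifF; last by apply/negP => ?; dlra.
have [h|h] := ltP (t - 2) (T - 2 - d).
  rewrite sum24_mid; [|dlra|dlra].
  by rewrite subrK opprB.
rewrite sum24_late; last dlra.
rewrite /final2 /final4 (_ : t - 2 < T - 2 = true); last by apply/idP; dlra.
rewrite (_ : t < T - 2 = false); last by apply/negP => ?; dlra.
by rewrite subrK; ring.
Qed.

Lemma prof_late t : T - 2 - d <= t -> t < T -> prof2 t = final2 t /\ prof4 t = final4 t.
Proof.
by move=> h1 h2; rewrite /prof2 /prof4 diff24_late// sum24_late//; split; field.
Qed.

Lemma prof_final t : T - 2 <= t -> t < T -> prof2 t = B e2 t /\ prof4 t = B e4 t.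
Proof.
move=> h1 h2; have [|-> ->] := prof_late _ h2; first dlra.
by rewrite /final2 /final4 !ifF//; apply/negP => ?; dlra.
Qed.

Lemma traceE4 t : 0 <= t -> trace t = prof4 t - prof4 (t - 2).
Proof.
move=> t0; rewrite /trace /prof2 /prof4 [diff24 t]/diff24 ifF; last first.
  by apply/negP => ?; dlra.
by field.
Qed.

Lemma trace_init t : 0 <= t -> t < d -> trace t = trace0 t.
Proof.
move=> t0 td; rewrite /trace.
have [-> _] : prof2 (t - 2) = A e2 (t - 2) /\ _ := @prof_init (t - 2) ltac:(dlra).
rewrite /prof2 /diff24 ifF; last by apply/negP => ?; dlra.
rewrite /sum24 (_ : t - 2 < 0 = true); last by apply/idP; dlra.
rewrite (_ : t < 0 = false); last by apply/negP => ?; dlra.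
by rewrite td; field.
Qed.

Lemma trace_final t : T - d <= t -> t < T -> trace t = traceT t.
Proof.
move=> h1 h2; rewrite /trace.
have [|-> _] := prof_final _ h2; first dlra.
have [||-> _] := @prof_late (t - 2); [dlra|dlra|].
rewrite /final2 (_ : t - 2 < T - 2 = true); last by apply/idP; dlra.
by rewrite subrK; ring.
Qed.

(** On a controlled edge the trace is realized only on a window of length 2 next to the data: (0, 2)
    for [fwd], (T - 2, T) for [bwd]. Away from it the wave will be cut off in time, so its profile
    there is immaterial. *)
Definition fwd (j : 'I_4) t :=
  if t < 0 then A j t else trace t - edge_sign j * A j (t - 2).
Definition bwd (j : 'I_4) t :=
  if t < T - 2 then edge_sign j * (trace (t + 2) - B j (t + 2)) else B j t.

Lemma edge_sign_sign j : is_sign (edge_sign j).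
Proof. by rewrite /edge_sign; case: ifP; [left|right]. Qed.

Lemma fwd_init j t : t < 0 -> fwd j t = A j t.
Proof. by rewrite /fwd => ->. Qed.

Lemma bwd_final j t : T - 2 <= t -> bwd j t = B j t.
Proof. by move=> h; rewrite /bwd ifF//; apply/negP => ?; dlra. Qed.

Lemma fwd_trace j t : 0 <= t -> t < 2 -> fwd j t + edge_sign j * fwd j (t - 2) = trace t.
Proof.
move=> t0 t2; rewrite (@fwd_init _ (t - 2)); last dlra.
by rewrite /fwd ifF ?subrK//; apply/negP => ?; dlra.
Qed.

Lemma bwd_trace j t : T - 2 <= t -> t < T ->
  bwd j t + edge_sign j * bwd j (t - 2) = trace t.
Proof.
move=> h1 h2; rewrite bwd_final// /bwd (_ : t - 2 < T - 2 = true); last by apply/idP;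
  dlra.
by rewrite mulrA (is_sign_sqr (edge_sign_sign j)) mul1r !subrK addrC subrK.
Qed.

Section locsq.
Hypotheses (lA : forall j, locsq (A j)) (lB : forall j, locsq (B j)).

Let locsq_at (f : R -> R) c : locsq f -> locsq (fun t => f (t + c)).
Proof.
move=> /(locsq_ray c (or_introl erefl : is_sign 1)); congr locsq.
by apply/funext => x; rewrite mul1r addrC.
Qed.

Lemma locsq_trace0 : locsq trace0.
Proof.
have := locsqZ 2^-1 (locsqB (locsqB (locsqD (locsq_at (-2) (lA e1)) (locsq_at (-2) (lA
  e2)))
  (locsq_at (-2) (lA e3))) (locsq_at (-2) (lA e4))).
by congr locsq; apply/funext => x; rewrite /trace0 mulrC.
Qed.

Lemma locsq_traceT : locsq traceT.
Proof.
have := locsqZ 2^-1 (locsqD (locsqD (locsqD (lB e1) (lB e2)) (lB e3)) (lB e4)).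
by congr locsq; apply/funext => x; rewrite /traceT mulrC.
Qed.

Let locsq_final2 : locsq final2.
Proof. by apply: locsq_if => //; apply: locsqB; apply: locsq_at => //;
  exact: locsq_traceT. Qed.

Let locsq_final4 : locsq final4.
Proof. by apply: locsq_if => //; apply: locsqB; apply: locsq_at => //;
  exact: locsq_traceT. Qed.

Let locsq_sum24 : locsq sum24.
Proof.
apply: locsq_if; first exact: locsqD.
apply: locsq_if.
  apply: locsqB; first exact/locsqZ/locsq_trace0.
  by apply: locsqB; exact: (@locsq_at _ (-2)).
apply: locsq_if; first exact: locsq_cst.
apply: locsq_if; last exact: locsqD.
by apply: locsqB; exact: locsq_at.
Qed.

Let locsq_diff24 : locsq diff24.
Proof. by apply: locsq_if; [exact: locsqB|apply: locsqN;
  exact: (locsq_at (-2) locsq_sum24)]. Qed.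

Lemma locsq_prof2 : locsq prof2.
Proof.
have := locsqZ 2^-1 (locsqD locsq_diff24 locsq_sum24).
by congr locsq; apply/funext => x; rewrite /prof2 mulrC.
Qed.

Lemma locsq_prof4 : locsq prof4.
Proof.
have := locsqZ 2^-1 (locsqB locsq_sum24 locsq_diff24).
by congr locsq; apply/funext => x; rewrite /prof4 mulrC.
Qed.

Lemma locsq_trace : locsq trace.
Proof. by apply: locsqD; [exact: locsq_prof2|exact: (locsq_at (-2) locsq_prof2)]. Qed.

Lemma locsq_fwd j : locsq (fwd j).
Proof.
apply: locsq_if => //; apply: locsqB; first exact: locsq_trace.
by apply: locsqZ; exact: (locsq_at (-2) (lA j)).
Qed.

Lemma locsq_bwd j : locsq (bwd j).
Proof.
apply: locsq_if => //; apply: locsqZ; apply: locsqB; apply: locsq_at => //.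
exact: locsq_trace.
Qed.

End locsq.
End profiles.

(** * The controlled solution *)

Definition edgewise (X : Type) (x1 x2 x3 x4 : X) (j : 'I_4) : X :=
  match nat_of_ord j with 0 => x1 | 1 => x2 | 2 => x3 | _ => x4 end.

Lemma edge_ind (P : 'I_4 -> Prop) : P e1 -> P e2 -> P e3 -> P e4 -> forall j, P j.
Proof.
move=> P1 P2 P3 P4 [[|[|[|[|//]]]] j4].
- by rewrite (_ : Ordinal j4 = e1)//; exact: val_inj.
- by rewrite (_ : Ordinal j4 = e2)//; exact: val_inj.
- by rewrite (_ : Ordinal j4 = e3)//; exact: val_inj.
- by rewrite (_ : Ordinal j4 = e4)//; exact: val_inj.
Qed.

Lemma sum_edges (R : realType) (f : 'I_4 -> R) :
  \sum_(j < 4) f j = f e1 + f e2 + f e3 + f e4.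
Proof.
rewrite !big_ord_recl big_ord0 addr0 !addrA.
by congr (f _ + f _ + f _ + f _); exact: val_inj.
Qed.

Section construction.
Context {R : realType}.
Variables (T d : R).
Hypotheses (d0 : 0 < d) (d1 : 2 * d <= 1) (dT : 2 * d <= T - 4).
Local Ltac dlra := move: (d0) (d1) (dT) => ? ? ?; lra.

Variables (u0 u1 v0 v1 : graph_fun R) (p q p' q' : 'I_4 -> R -> R) (c0 c1 : R).
Hypotheses (lp : forall j, locsq (p j)) (lq : forall j, locsq (q j)).
Hypotheses (lp' : forall j, locsq (p' j)) (lq' : forall j, locsq (q' j)).
Hypotheses (p_out : forall j x, ~~ (0 < x < 1) -> p j x = 0)
  (q_out : forall j x, ~~ (0 < x < 1) -> q j x = 0)
  (p'_out : forall j x, ~~ (0 < x < 1) -> p' j x = 0)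
  (q'_out : forall j x, ~~ (0 < x < 1) -> q' j x = 0).
Hypotheses (u0E : forall j x, 0 <= x -> x <= 1 -> u0 j x = u0 j 0 + itg (p j) 0 x)
  (v0E : forall j x, 0 <= x -> x <= 1 -> v0 j x = v0 j 0 + itg (p' j) 0 x).
Hypotheses (qE : forall j x, 0 < x < 1 -> q j x = u1 j x)
  (q'E : forall j x, 0 < x < 1 -> q' j x = v1 j x).
Hypotheses (u0_vertex : forall j, u0 j 0 = c0) (v0_vertex : forall j, v0 j 0 = c1).
Hypotheses (u03 : u0 e3 1 = 0) (u04 : u0 e4 1 = 0) (v03 : v0 e3 1 = 0) (v04 : v0 e4 1 =
  0).

Variables (m m1 m2 n n1 n2 : R -> R).
Hypotheses (hm : C2 m m1 m2) (hn : C2 n n1 n2).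
Hypotheses (m_lo : forall t, t <= d -> m t = 1 /\ m1 t = 0)
  (m_hi : forall t, 2 * d <= t -> m t = 0 /\ m1 t = 0).
Hypotheses (n_lo : forall x, x <= d / 2 -> n x = 1 /\ n1 x = 0)
  (n_hi : forall x, d <= x -> n x = 0 /\ n1 x = 0).

Let sg := @edge_sign R.
Let sgP j : is_sign (sg j) := edge_sign_sign j.
Let A j := profile (sg j) (p j) (q j).
Let B j t := profile (sg j) (p' j) (q' j) (t - T).
Let g2 := prof2 T d A B.
Let g4 := prof4 T d A B.
Let tr := trace T d A B.
Let gU := fwd T d A B.
Let gV := bwd T d A B.

Let lA j : locsq (A j). Proof. exact: locsq_profile. Qed.
Let lB j : locsq (B j).
Proof.
have := locsq_ray (- T) (or_introl erefl : is_sign (1 : R)) (locsq_profile (sg j) (lp'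
  j) (lq' j)).
by congr locsq; apply/funext => x; rewrite /B mul1r addrC.
Qed.
Let lg2 : locsq g2. Proof. exact: locsq_prof2. Qed.
Let lg4 : locsq g4. Proof. exact: locsq_prof4. Qed.
Let ltr : locsq tr. Proof. exact: locsq_trace. Qed.
Let lgU j : locsq (gU j). Proof. exact: locsq_fwd. Qed.
Let lgV j : locsq (gV j). Proof. exact: locsq_bwd. Qed.

Let P t := c0 + itg tr 0 t.
Let P_prim : prim P tr.
Proof.
apply: eq_prim (primD (prim_cst c0) (prim_itg 0 (locsq_locint ltr))) => x //.
by rewrite add0r.
Qed.

(* The wave [U] starts from the initial state, [V] ends at the final state, [S2]
   and [S4] do both. At the interior vertex [U] has the trace [P] up to t = 2, [V]
   from t = T - 2 on, [S2] and [S4] always. *)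
Let U j := dal (sg j) (u0 j 1) (-1) 2 (gU j).
Let V j := dal (sg j) (v0 j 1) (T - 1) 2 (gV j).
Let S2 := dal 1 (u0 e2 1) (-1) 2 g2.
Let S4 := dal (-1) (u0 e4 1) (-1) 2 g4.

Let sg1 : sg e1 = 1. Proof. by []. Qed.
Let sg3 : sg e3 = -1. Proof. by []. Qed.
(* At x = 1 and t = b + 1 both integrals of [dal] are empty. *)
Let dal_end s c b g : dal s c b 2 g (b + 1) 1 = c :> R.
Proof.
rewrite /dal addrK (_ : b + 1 + 1 - 2 = b); last by ring.
by rewrite itgxx mulr0 !addr0.
Qed.

Let init_match j g : locsq g -> (forall y, y < 0 -> g y = A j y) ->
  let S := dal (sg j) (u0 j 1) (-1) 2 g in
  (forall x, 0 <= x <= 1 -> S 0 x = u0 j x) /\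
  (forall x, 0 < x < 1 -> dalt (sg j) 2 g 0 x = u1 j x).
Proof.
move=> lg gA; apply: (dal_match (x0 := 1) (sgP j) lg (lp j) (@p_out j) (@q_out j) (@u0E
  j) (@qE j)).
- by move=> y /andP[_ y0]; rewrite subr0 gA.
- by rewrite ler01 lexx.
- by rewrite -[X in dal _ _ _ _ _ X _](addNr 1) dal_end.
Qed.

Let final_match j c b g x0 : locsq g -> (forall y, T - 2 <= y -> y < T -> g y = B j y) ->
  0 <= x0 <= 1 -> dal (sg j) c b 2 g T x0 = v0 j x0 ->
  (forall x, 0 <= x <= 1 -> dal (sg j) c b 2 g T x = v0 j x) /\
  (forall x, 0 < x < 1 -> dalt (sg j) 2 g T x = v1 j x).
Proof.
move=> lg gB x01; apply: (dal_match (sgP j) lg (lp' j) (@p'_out j) (@q'_out j) (@v0E j)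
  (@q'E j)) => //.
by move=> y /andP[/ltW ? ?]; exact: gB.
Qed.

Let U_init j := init_match (lgU j) (fun y y0 => fwd_init T d A B j y0).
Let S2_init := @init_match e2 g2 lg2 (fun y y0 => (prof_init T d A B y0).1).
Let S4_init := @init_match e4 g4 lg4 (fun y y0 => (prof_init T d A B y0).2).

Let V_final j : (forall x, 0 <= x <= 1 -> V j T x = v0 j x) /\
  (forall x, 0 < x < 1 -> dalt (sg j) 2 (gV j) T x = v1 j x).
Proof.
apply: (final_match (x0 := 1) (lgV j)).
- by move=> y yT _; exact: bwd_final.
- by rewrite ler01 lexx.
- by rewrite -[X in dal _ _ _ _ _ X _](subrK 1) dal_end.
Qed.

Let S4_end t : S4 t 1 = 0.
Proof. by rewrite /S4 /dal u04 (_ : t + 1 - 2 = t - 1); ring. Qed.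

Let S4_final : (forall x, 0 <= x <= 1 -> S4 T x = v0 e4 x) /\
  (forall x, 0 < x < 1 -> dalt (-1) 2 g4 T x = v1 e4 x).
Proof.
apply: (@final_match e4 _ _ g4 1 lg4).
- by move=> y h1 h2; have [] := prof_final A B d0 d1 dT h1 h2.
- by rewrite ler01 lexx.
- by rewrite v04; exact: S4_end.
Qed.

Let dal_trace s c b g lo hi t0 : locsq g -> lo <= t0 <= hi -> dal s c b 2 g t0 0 = P t0 ->
  (forall t, lo < t -> t < hi -> g t + s * g (t - 2) = tr t) ->
  forall t, lo <= t <= hi -> dal s c b 2 g t 0 = P t.
Proof.
move=> lg t0in E0 gtr t tin.
have pd := wave_primt (wave_dal1 s c b 2 lg) 0.
apply: (prim_eq_on pd P_prim t0in _ E0 tin) => y y1 y2.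
by rewrite /dalt subr0 addr0 gtr.
Qed.

Let P0 : P 0 = c0. Proof. by rewrite /P itgxx addr0. Qed.

Let S4_trace t : 0 <= t <= T -> S4 t 0 = P t.
Proof.
apply: (@dal_trace _ _ _ g4 0 T 0 lg4).
- by rewrite lexx /=; dlra.
- by rewrite P0 -(u0_vertex e4); apply: S4_init.1; rewrite lexx ler01.
- by move=> y y0 _; rewrite /tr traceE4 ?(ltW y0)// mulN1r.
Qed.

(** The final profiles determine the final state only up to constants. On e4 the Dirichlet end fixes
    the constant, and the trace [P] is thereby forced to end at the right vertex value. The Neumann
    end of e2 fixes nothing, and there the constant is obtained from [P] at the vertex. *)
Let PT : P T = c1.
Proof.
rewrite -S4_trace; last by rewrite lexx andbT; dlra.
by rewrite S4_final.1 ?lexx ?ler01.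
Qed.

Let S2_trace t : 0 <= t <= T -> S2 t 0 = P t.
Proof.
apply: (@dal_trace _ _ _ g2 0 T 0 lg2).
- by rewrite lexx /=; dlra.
- by rewrite P0 -(u0_vertex e2); apply: S2_init.1; rewrite lexx ler01.
- by move=> y y0 _; rewrite mul1r.
Qed.

Let S2_final : (forall x, 0 <= x <= 1 -> S2 T x = v0 e2 x) /\
  (forall x, 0 < x < 1 -> dalt 1 2 g2 T x = v1 e2 x).
Proof.
apply: (@final_match e2 _ _ g2 0 lg2).
- by move=> y h1 h2; have [] := prof_final A B d0 d1 dT h1 h2.
- by rewrite ler01 lexx.
- rewrite v0_vertex -PT; apply: S2_trace; rewrite lexx andbT; dlra.
Qed.

Let U_trace j t : 0 <= t <= 2 -> U j t 0 = P t.
Proof.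
apply: (@dal_trace _ _ _ (gU j) 0 2 0 (lgU j)).
- by rewrite lexx /=.
- by rewrite P0 -(u0_vertex j); apply: (U_init j).1; rewrite lexx ler01.
- by move=> y /ltW y0 y2; exact: fwd_trace.
Qed.

Let V_trace j t : T - 2 <= t <= T -> V j t 0 = P t.
Proof.
apply: (@dal_trace _ _ _ (gV j) (T - 2) T T (lgV j)).
- by rewrite lexx andbT; lra.
- by rewrite PT -(v0_vertex j); apply: (V_final j).1; rewrite lexx ler01.
- by move=> y /ltW y0 y2; exact: bwd_trace.
Qed.

Let mT t := m (T - t).
Let mT1 t := - m1 (T - t).
Let mT2 t := m2 (T - t).
Let hmT : C2 mT mT1 mT2. Proof. exact: C2_refl. Qed.
Let mP t := 1 + (-1 * m t + -1 * mT t).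
Let mP1 t := 0 + (-1 * m1 t + -1 * mT1 t).
Let mP2 t := 0 + (-1 * m2 t + -1 * mT2 t).
Let hmP : C2 mP mP1 mP2.
Proof. by apply: C2D; [exact: C2_cst|apply: C2D; exact: C2Z]. Qed.

(* [Q] supplies the trace [P] while [m] and [mT] are switched off; [n] keeps it away
   from the exterior vertex. *)
Let Q := dal 0 c0 0 0 tr.
Let one : R -> R := fun=> 1.
Let zero : R -> R := fun=> 0.

(** At the vertex [n = 1], each of [U], [V], [Q] has the trace [P] as long as its time factor is
    nonzero, and these factors add up to 1; so the gluing keeps the trace [P]. *)
Let Wc j t x := m t * one x * U j t x + mT t * one x * V j t x + mP t * n x * Q t x.
Let vc j t x :=
  (m1 t * one x * U j t x + m t * one x * dalt (sg j) 2 (gU j) t x) +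
  (mT1 t * one x * V j t x + mT t * one x * dalt (sg j) 2 (gV j) t x) +
  (mP1 t * n x * Q t x + mP t * n x * dalt 0 0 tr t x).
Let uc j t x :=
  (m t * zero x * U j t x + m t * one x * dalx (sg j) 2 (gU j) t x) +
  (mT t * zero x * V j t x + mT t * one x * dalx (sg j) 2 (gV j) t x) +
  (mP t * n1 x * Q t x + mP t * n x * dalx 0 0 tr t x).

Let wave_c j : exists h, wave (Wc j) (vc j) (uc j) h.
Proof.
eexists; apply: waveD; first apply: waveD.
- exact: (wave_dal _ _ _ _ hm (C2_cst 1) (lgU j)).
- exact: (wave_dal _ _ _ _ hmT (C2_cst 1) (lgV j)).
- exact: (wave_dal _ _ _ _ hmP hn ltr).
Qed.

Let m_early t : t <= d -> [/\ m t = 1, mT t = 0,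
  mP t = 0 & m1 t = 0 /\ mT1 t = 0 /\ mP1 t = 0].
Proof.
move=> td; have [E1 E2] := m_lo td.
have [E3 E4] : mT t = 0 /\ mT1 t = 0.
  by rewrite /mT /mT1; have [|-> ->] := @m_hi (T - t); [dlra|rewrite oppr0].
by rewrite /mP /mP1 E1 E2 E3 E4; split=> //; [ring|split=> //; split=> //; ring].
Qed.

Let m_late t : T - d <= t -> [/\ m t = 0, mT t = 1,
  mP t = 0 & m1 t = 0 /\ mT1 t = 0 /\ mP1 t = 0].
Proof.
move=> td; have [|E1 E2] := @m_hi t; first dlra.
have [E3 E4] : mT t = 1 /\ mT1 t = 0.
  by rewrite /mT /mT1; have [|-> ->] := @m_lo (T - t); [lra|rewrite oppr0].
by rewrite /mP /mP1 E1 E2 E3 E4; split=> //; [ring|split=> //; split=> //; ring].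
Qed.

Let Wc_init j : (forall x, 0 <= x <= 1 -> Wc j 0 x = u0 j x) /\
  (forall x, 0 < x < 1 -> vc j 0 x = u1 j x).
Proof.
have [E1 E2 E3 [E4 [E5 E6]]] := m_early (ltW d0).
split=> x x01; rewrite /Wc /vc E1 E2 E3 ?E4 ?E5 ?E6 /one.
  by rewrite -((U_init j).1 x x01) -/(U j); ring.
by rewrite -((U_init j).2 x x01); ring.
Qed.

Let Wc_final j : (forall x, 0 <= x <= 1 -> Wc j T x = v0 j x) /\
  (forall x, 0 < x < 1 -> vc j T x = v1 j x).
Proof.
have [|E1 E2 E3 [E4 [E5 E6]]] := @m_late T; first dlra.
split=> x x01; rewrite /Wc /vc E1 E2 E3 ?E4 ?E5 ?E6 /one.
  by rewrite -((V_final j).1 x x01); ring.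
by rewrite -((V_final j).2 x x01); ring.
Qed.

Let Q_trace t : Q t 0 = P t.
Proof. by rewrite /Q /dal mul0r addr0 subr0. Qed.

Let n0 : n 0 = 1 /\ n1 0 = 0. Proof. by apply: n_lo; dlra. Qed.
Let n01 : n 1 = 0 /\ n1 1 = 0. Proof. by apply: n_hi; dlra. Qed.

Let Wc_trace j t : 0 <= t <= T -> Wc j t 0 = P t.
Proof.
move=> /andP[t0 tT]; rewrite /Wc Q_trace n0.1 /one /mP.
have -> : m t * 1 * U j t 0 = m t * P t.
  have [t2|t2] := leP t 2; first by rewrite U_trace ?t0// mulr1.
  by have [->] := @m_hi t ltac:(dlra); rewrite !mul0r.
have -> : mT t * 1 * V j t 0 = mT t * P t.
  have [t2|t2] := leP (T - 2) t; first by rewrite V_trace ?t2// mulr1.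
  by rewrite /mT; have [->] := @m_hi (T - t) ltac:(dlra); rewrite !mul0r.
by ring.
Qed.

Let Wc_dirichlet t : Wc e3 t 1 = 0.
Proof.
rewrite /Wc n01.1 /U /V /dal sg3 u03 v03.
by rewrite (_ : t + 1 - 2 = t - 1); ring.
Qed.

Let uc_neumann t : uc e1 t 1 = 0.
Proof.
rewrite /uc n01.1 n01.2 /dalx sg1 /zero.
by rewrite (_ : t + 1 - 2 = t - 1); ring.
Qed.

Let flux t := uc e1 t 0 + dalx 1 2 g2 t 0 + uc e3 t 0 + dalx (-1) 2 g4 t 0.

(** Here each edge contributes twice its signed incoming profile minus the common trace, so the sum
    is zero precisely for [trace0]. In the late case the contribution is the trace minus twice the
    outgoing profile, which leads to [traceT]. *)
Let flux_early t : 0 <= t -> t < d -> flux t = 0.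
Proof.
move=> t0 td; have [E1 E2 E3 _] := m_early (ltW td).
have uE j : uc j t 0 = 2 * (sg j * A j (t - 2)) - tr t.
  rewrite /uc E1 E2 E3 /dalx subr0 addr0 /gU (fwd_init _ _ _ _ _ (_ : t - 2 < 0));
    last dlra.
  rewrite /fwd ifF; last by apply/negP => ?; lra.
  by rewrite /zero /one -/tr -/sg; ring.
have [F2 F4] : prof2 T d A B (t - 2) = A e2 (t - 2) /\ prof4 T d A B (t - 2) = A e4 (t
  - 2).
  by apply: prof_init; dlra.
have G2 : dalx 1 2 g2 t 0 = 2 * A e2 (t - 2) - tr t.
  by rewrite /dalx subr0 addr0 /tr /trace -/g2 [g2 (t - 2)]F2; ring.
have G4 : dalx (-1) 2 g4 t 0 = - 2 * A e4 (t - 2) - tr t.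
  by rewrite /dalx subr0 addr0 /tr traceE4// -/g4 [g4 (t - 2)]F4; ring.
by rewrite /flux !uE G2 G4 sg1 sg3 /tr trace_init// /trace0; field.
Qed.

Let flux_late t : T - d <= t -> t < T -> flux t = 0.
Proof.
move=> t0 tT; have [E1 E2 E3 _] := m_late t0.
have uE j : uc j t 0 = tr t - 2 * B j t.
  have h1 : T - 2 <= t by dlra.
  have := bwd_trace A B d0 d1 dT j h1 tT;
    rewrite (bwd_final A B d0 d1 dT j h1) -/tr => <-.
  rewrite /uc E1 E2 E3 /dalx subr0 addr0 /gV (bwd_final A B d0 d1 dT j h1).
  by rewrite /zero /one -/sg; ring.
have [F2 F4] : prof2 T d A B t = B e2 t /\ prof4 T d A B t = B e4 t.
  by apply: prof_final => //; dlra.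
have G2 : dalx 1 2 g2 t 0 = tr t - 2 * B e2 t.
  by rewrite /dalx subr0 addr0 /tr /trace -/g2 [g2 t]F2; ring.
have G4 : dalx (-1) 2 g4 t 0 = tr t - 2 * B e4 t.
  by rewrite /dalx subr0 addr0 /tr (traceE4 A B d0 d1 dT) -/g4; [rewrite [g4 t]F4;
    ring|dlra].
by rewrite /flux !uE G2 G4 /tr trace_final// /traceT; field.
Qed.

(** The truncation is not redundant: nothing is known about [flux] outside [0, T], whereas [Z] at
    the times 0 and T depends on [rho] at distance up to [d] on both sides. *)
Let rho t := if t < d then 0 else if t < T - d then - flux t else 0.

Let rho_flux t : 0 < t -> t < T -> flux t + rho t = 0.
Proof.
move=> t0 tT; rewrite /rho; case: ltP => td; first by rewrite flux_early ?addr0 ?(ltW t0).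
by case: ltP => tTd; [rewrite subrr|rewrite flux_late ?addr0].
Qed.

(** Hidden regularity: at a fixed point the flux is square integrable in time, being made of
    profiles along rays and their primitives, times cut-offs. *)
Let lrho : locsq rho.
Proof.
have sec2 j : locsq (fun t => uc j t 0).
  by have [h /wave_locsq2x/locsq2_sec2] := wave_c j; apply.
have sec2' (s : R) g : locsq g -> locsq (fun t => dalx s 2 g t 0).
  by move=> lg; exact: (locsq2_sec2 (wave_locsq2x (wave_dal1 s 0 0 2 lg))).
apply: locsq_if; first exact: locsq_cst.
apply: locsq_if; last exact: locsq_cst.
exact: locsqN (locsqD (locsqD (locsqD (sec2 _) (sec2' _ _ lg2)) (sec2 _)) (sec2' _ _
  lg4)).
Qed.

(* The wave [Z] vanishes at the interior vertex and has flux [rho] there. *)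
Let gz t := - 2^-1 * rho t.
Let lgz : locsq gz. Proof. exact: locsqZ lrho. Qed.
Let Zd := dal (-1) 0 0 0 gz.
Let Z t x := one t * n x * Zd t x.
Let Zt t x := zero t * n x * Zd t x + one t * n x * dalt (-1) 0 gz t x.
Let Zx t x := one t * n1 x * Zd t x + one t * n x * dalx (-1) 0 gz t x.

Let wave_z : exists h, wave Z Zt Zx h.
Proof. eexists; exact: (wave_dal (-1) 0 0 0 (C2_cst 1) hn lgz). Qed.

Let Z0 t : Z t 0 = 0.
Proof. by rewrite /Z /Zd /dal !subr0 addr0; ring. Qed.

Let Z1 t : Z t 1 = 0.
Proof. by rewrite /Z n01.1; ring. Qed.

Let Zx0 t : Zx t 0 = rho t.
Proof.
by rewrite /Zx n0.1 n0.2 /Zd /dal /dalx !subr0 addr0 /gz /one; field.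
Qed.

(** Finite speed of propagation: [n] confines [Z] to [x < d], where at time [t0] only the profile on
    (t0 - d, t0 + d) is seen. This is why Kirchhoff's law had to be arranged in advance for a time
    [d] at both ends. *)
Let Z_rest t0 : (forall y, t0 - d < y -> y < t0 + d -> rho y = 0) ->
  (forall x, 0 <= x <= 1 -> Z t0 x = 0) /\ (forall x, 0 < x < 1 -> Zt t0 x = 0).
Proof.
move=> r0; have gz0 y : t0 - d < y -> y < t0 + d -> gz y = 0.
  by move=> y1 y2; rewrite /gz r0// mulr0.
split=> x /andP[x0 x1].
  rewrite /Z; have [dx|xd] := leP d x; first by rewrite (n_hi dx).1; ring.
  rewrite /Zd /dal subr0 -(itg_cat 0 (t0 - x) (t0 + x) (locsq_locint lgz)).
  rewrite (@eq_itg _ gz (fun=> 0) (t0 - x)).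
  - by rewrite itg_cst; ring.
  - exact: (locsq_locint lgz).
  - exact: locint_cst.
  - lra.
  - by move=> y y1 y2; apply: gz0; lra.
rewrite /Zt; have [dx|xd] := leP d x; first by rewrite (n_hi dx).1; ring.
by rewrite /dalt subr0 !gz0; [rewrite /zero; ring|lra|lra|lra|lra].
Qed.

Let rho_early y : 0 - d < y -> y < 0 + d -> rho y = 0.
Proof. by move=> _; rewrite add0r /rho => ->. Qed.

Let rho_late y : T - d < y -> y < T + d -> rho y = 0.
Proof.
move=> y1 _; rewrite /rho ifF; last by apply/negP => ?; dlra.
by rewrite ifF//; apply/negP => ?; lra.
Qed.

(** [S2] and [S4] carry no cut-off, hence no source, so the control is supported in e1 and e3: it
    consists of the commutators from the gluing and, on e3, of the one from localizing [Z]. *)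
Lemma controllable_edges : exists2 h : 'I_4 -> R * R -> R, L2control T h
  & exists u v : R -> graph_fun R, [/\ wave_solution T h u0 u1 u v,
      eq_H1Delta (u T) v0 & eq_L2G (v T) v1].
Proof.
have [h1 w1] := wave_c e1; have [h3 w3] := wave_c e3; have [hz wz] := wave_z.
pose W := edgewise (Wc e1) S2 (fun t x => Wc e3 t x + Z t x) S4.
pose v := edgewise (vc e1) (dalt 1 2 g2) (fun t x => vc e3 t x + Zt t x) (dalt (-1) 2 g4).
pose u := edgewise (uc e1) (dalx 1 2 g2) (fun t x => uc e3 t x + Zx t x) (dalx (-1) 2 g4).
pose h := edgewise h1 (fun _ _ => 0) (fun t x => h3 t x + hz t x) (fun _ _ => 0).
have wW j : wave (W j) (v j) (u j) (h j).
  elim/edge_ind: j; rewrite /W /v /u /h /edgewise/=.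
  - exact: w1.
  - exact: wave_dal1.
  - exact: waveD.
  - exact: wave_dal1.
have T0 : 0 <= T by dlra.
have [Zi Zti] := Z_rest rho_early; have [Zf Ztf] := Z_rest rho_late.
exists (fun j z => h j z.1 z.2); first exact: wave_L2control wW.
exists (fun t j => W j t), (fun t j => v j t); split.
- apply: (wave_solution_assembly wW).
  + by move=> j; elim/edge_ind: j => //; rewrite /omega !inE.
  + move=> t tT; rewrite /W /edgewise/= !Wc_trace// S2_trace// S4_trace// Z0 addr0.
    by [].
  + by move=> t _; rewrite /W /edgewise/= Wc_dirichlet Z1 addr0 S4_end.
  + move=> t _; rewrite /u /edgewise/= uc_neumann; split => //.
    by rewrite /dalx (_ : t + 1 - 2 = t - 1); ring.
  + move=> t /andP[t0 tT]; rewrite sum_edges /u /edgewise/= Zx0.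
    by rewrite -[RHS](rho_flux t0 tT) /flux; ring.
  + move=> j; elim/edge_ind: j => x x01; rewrite /W /edgewise/=.
    * exact: (Wc_init e1).1.
    * exact: S2_init.1.
    * by rewrite (Wc_init e3).1// Zi// addr0.
    * exact: S4_init.1.
  + move=> j; elim/edge_ind: j => x x01; rewrite /v /edgewise/=.
    * exact: (Wc_init e1).2.
    * exact: S2_init.2.
    * by rewrite (Wc_init e3).2// Zti// addr0.
    * exact: S4_init.2.
- move=> j x; rewrite in_itv/=; elim/edge_ind: j => x01; rewrite /W /edgewise/=.
  + exact: (Wc_final e1).1.
  + exact: S2_final.1.
  + by rewrite (Wc_final e3).1// Zf// addr0.
  + exact: S4_final.1.
- move=> j; apply: aeW => x; rewrite in_itv/=; elim/edge_ind: j => x01;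
  rewrite /v /edgewise/=.
  + exact: (Wc_final e1).2.
  + exact: S2_final.2.
  + by rewrite (Wc_final e3).2// Ztf// addr0.
  + exact: S4_final.2.
Qed.

End construction.

Theorem theorem1p7 (R : realType) (T : R) (hT : 4 < T) :
  exactly_controllable T.
Proof.
move=> u0 u1 v0 v1 [Hu0 [u01 [u02 u03]] [u0D3 u0D4]] Lu1 [Hv0 [v01 [v02 v03]] [v0D3
  v0D4]] Lv1.
have ex (w : graph_fun R) (Hw : forall j, H1 (w j)) : exists p : 'I_4 -> R -> R, forall j,
    [/\ locsq (p j), forall x, ~~ (0 < x < 1) -> p j x = 0 &
      forall x, 0 <= x -> x <= 1 -> w j x = w j 0 + itg (p j) 0 x].
  suff /choice[p Hp] j : exists p, [/\ locsq p, forall x, ~~ (0 < x < 1) -> p x = 0 &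
      forall x, 0 <= x -> x <= 1 -> w j x = w j 0 + itg p 0 x] by exists p.
  have [cw _ [g Lg wg]] := Hw j.
  exists (g \_ `]0, 1[); split; first exact: L2_locsq.
    by move=> x x01; rewrite patchE ifF//; apply/negbTE; rewrite notin_setE/= in_itv/=;
      apply/negP.
  exact: H1_ftc.
have [p Hp] := ex u0 Hu0; have [p' Hp'] := ex v0 Hv0.
have out (w : graph_fun R) j x : ~~ (0 < x < 1) -> (w j \_ `]0, 1[) x = 0.
  by move=> x01; rewrite patchE ifF//; apply/negbTE; rewrite notin_setE/= in_itv/=;
    apply/negP.
have inn (w : graph_fun R) j x : 0 < x < 1 -> (w j \_ `]0, 1[) x = w j x.
  by move=> x01; rewrite patchE ifT// inE/= in_itv.
(* [2 * d <= T - 4] puts (-2, d), where the initial state acts, before (T - 4 - d, T), where the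
   final one does. [2 * d <= 1] ends the time cut-offs within the windows where [U] and [V] have the
   trace [P], and the space cut-off before [x = 1]. *)
pose d := Num.min 1 (T - 4) / 2.
have dm : 0 < Num.min 1 (T - 4) by rewrite lt_min ltr01 subr_gt0.
have d0 : 0 < d by rewrite divr_gt0.
have dd : 2 * d = Num.min 1 (T - 4) by rewrite /d; field.
have d1 : 2 * d <= 1 by rewrite dd ge_min lexx.
have dT : 2 * d <= T - 4 by rewrite dd ge_min lexx orbT.
have [m [m1 [m2 [hm m_lo m_hi]]]] := cutoff_exists d0.
have [n [n1 [n2 [hn n_lo n_hi]]]] := cutoff_exists (divr_gt0 d0 (ltr0Sn R 1)).
have n_hi' x : d <= x -> n x = 0 /\ n1 x = 0.
  by move=> h; apply: n_hi; rewrite mulrC divfK.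
apply: (@controllable_edges _ T d d0 d1 dT u0 u1 v0 v1 p (fun j => u1 j \_ `]0, 1[)
  p' (fun j => v1 j \_ `]0, 1[) (u0 e1 0) (v0 e1 0) _ _ _ _ _ _ _ _ _ _ _ _ _ _
  u0D3 u0D4 v0D3 v0D4 m m1 m2 n n1 n2 hm hn m_lo m_hi n_lo n_hi').
- by move=> j; have [] := Hp j.
- by move=> j; exact: L2_locsq.
- by move=> j; have [] := Hp' j.
- by move=> j; exact: L2_locsq.
- by move=> j; have [] := Hp j.
- exact: out.
- by move=> j; have [] := Hp' j.
- exact: out.
- by move=> j; have [] := Hp j.
- by move=> j; have [] := Hp' j.
- exact: inn.
- exact: inn.
- by move=> j; elim/edge_ind: j; rewrite ?u01 ?u02 ?u03.
- by move=> j; elim/edge_ind: j; rewrite ?v01 ?v02 ?v03.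
Qed.
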